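(* Let $K=\mathbb{R}$ or $\mathbb{C}$. Let $T$ be the Takasaki quandle of the abelian group $$H=\mathbb{Z}_{2n_1}\times\cdots\times\mathbb{Z}_{2n_k}\times\mathbb{Z}_{2n'_1}\times\cdots\times\mathbb{Z}_{2n'_{k'}}\times\mathbb{Z}_{m'_1}\times\cdots\times\mathbb{Z}_{m'_{d'}},$$ where all $n_i$ ($1\le i\le k$) are even, all $n'_i$ ($1\le i\le k'$) are odd, all $m'_i$ ($1\le i\le d'$) are odd, $k+k'\ge 1$, and $H$ is not isomorphic to a direct product of copies of $\mathbb{Z}_2$ and $\mathbb{Z}_4$. Let $\tilde H=2H=\{h+h: h\in H\}$ and let $X_i$, $0\le i\le 2^{k+k'}-1$, be the orbits of $\mathrm{Inn}(T)$ on $T$. Then $K[T]$ decomposes as a direct sum of simple right ideals $$K[T]=\bigoplus_{i=0}^{2^{k+k'}-1}\left(\bigoplus_{j=1}^{2^k}U_{i,j}\ \oplus\bigoplus_{j=1}^{(|\tilde H|-2^k)/2}V_{i,j}\right),$$ where for each $i$ the inner sum equals $K[X_i]$ (the span of $X_i$), and, as representations of $\mathrm{Inn}(X_i)\cong\mathrm{Dih}(\tilde H)$, $U_{i,j}$ is equivalent to $\phi_j$ and $V_{i,j}$ is equivalent to $\psi_j$. Here $\{\phi_j: 1\le j\le 2^k\}$ is the set of degree-one representations of $\mathrm{Dih}(\tilde H)$ over $K$ with $\phi_j(s)=1$, and $\{\psi_j:1\le j\le(|\tilde H|-2^k)/2\}$ is a complete set of pairwise inequivalent irreducible degree-two representations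 of $\mathrm{Dih}(\tilde H)$ over $K$.
   Context: The Takasaki quandle of a finite additive abelian group $H$ is the set $T=H$ with operation $a\triangleright b=2b-a$. For $x\in T$ let $R_x:T\to T$, $R_x(y)=y\triangleright x$; $\mathrm{Inn}(T)$ is the permutation group generated by all $R_x$, $x\in T$. The quandle ring $K[T]$ is the $K$-vector space with basis $T$ and the (in general non-associative) bilinear multiplication extending $\triangleright$. A right ideal of $K[T]$ is a $K$-subspace $I$ with $I\cdot K[T]\subseteq I$; it is simple if it is nonzero and contains no right ideals of $K[T]$ other than $0$ and itself. For an orbit $X_i$, $\mathrm{Inn}(X_i)$ denotes the permutation group of $X_i$ generated by the restrictions $R_x|_{X_i}$ for all $x\in T$; it acts linearly on $K[X_i]$ by permuting the basis $X_i$. $\mathrm{Dih}(\tilde H)=\langle \tilde H,s\mid s^2=1,\ shs^{-1}=h^{-1}\ (h\in\tilde H)\rangle=\tilde H\rtimes\mathbb{Z}_2$. The orbits are the products of orbits of the cyclic factors: in each factor $\mathbb{Z}_{n}$ with $n$ even the orbits are the even residues (symbol $0$) and the odd residues (symbol $1$); each factor of odd order is a single orbit (symbol $0$). An orbit is thus labelled by a $0/1$ vector $\varepsilon$, read as a binary number and numbered by the resulting ordering; $X_0$ is the orbit with all symbols $0$, so $X_0=2H$, and the orbit labelled by $\varepsilon$ is $\varepsilon+X_0$. Let $e_0=(0,\dots,0)$ and let $e_l\in H$ have $l$-th coordinate $1$ and all others $0$. $\mathrm{Inn}(X_0)$ is identified with $\mathrm{Dih}(\tilde H)$ by letting the abelian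 group generated by the maps $(R_{e_l}R_{e_0})|_{X_0}$ (translations) correspond to $\tilde H$ and $R_{e_0}|_{X_0}$ correspond to $s$. For the orbit $X_i=\varepsilon+X_0$, $\mathrm{Inn}(X_i)$ is identified with $\mathrm{Inn}(X_0)$ through the shift bijection $X_0\to X_i$, $x\mapsto x+\varepsilon$, under which $R_x|_{X_0}$ corresponds to $R_{x+\varepsilon}|_{X_i}$. *)

(* Defs.v *)
From HB Require Import structures.
From mathcomp Require Import all_boot all_order all_algebra all_fingroup.
From mathcomp Require Import mxrepresentation complex reals.

Set Implicit Arguments.
Unset Strict Implicit.
Unset Printing Implicit Defensive.

Import GRing.Theory.
Local Open Scope ring_scope.

(* The abelian group \prod_l Z/(N l), for positive N l. It is not built on
   'Z_(N l), which is Z/2 when N l = 1. *)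
Definition cyclic_prod (I : finType) (N : I -> nat) : Type :=
  {dffun forall l : I, 'I_(N l).-1.+1}.

HB.instance Definition _ (I : finType) (N : I -> nat) :=
  Finite.on (cyclic_prod N).

Section CyclicProd.
Variables (I : finType) (N : I -> nat).
Implicit Types a b c : cyclic_prod N.

Definition cp_zero : cyclic_prod N := [ffun l => 0].
Definition cp_opp a : cyclic_prod N := [ffun l => - a l].
Definition cp_add a b : cyclic_prod N := [ffun l => a l + b l].

Fact cp_addA : associative cp_add.
Proof. by move=> a b c; apply/ffunP=> l; rewrite !ffunE addrA. Qed.
Fact cp_addC : commutative cp_add.
Proof. by move=> a b; apply/ffunP=> l; rewrite !ffunE addrC. Qed.
Fact cp_add0 : left_id cp_zero cp_add.
Proof. by move=> a; apply/ffunP=> l; rewrite !ffunE add0r. Qed.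
Fact cp_addN : left_inverse cp_zero cp_opp cp_add.
Proof. by move=> a; apply/ffunP=> l; rewrite !ffunE addNr. Qed.

HB.instance Definition _ :=
  GRing.isZmodule.Build (cyclic_prod N) cp_addA cp_addC cp_add0 cp_addN.
End CyclicProd.

Section QuandleRing.
Variables (K : fieldType) (T : finType) (op : T -> T -> T).

(* K^o only serves to equip the functions T -> K with their K-vector space
   structure; the pointwise product of functions is not used. *)
Definition quandle_ring := {ffun T -> K^o}.

Definition qr_basis (x : T) : quandle_ring := [ffun y => (x == y)%:R].

Definition qr_mul (u v : quandle_ring) : quandle_ring :=
  \sum_x \sum_y ((u x : K) * (v y : K)) *: qr_basis (op x y).

Definition right_ideal (I : {vspace quandle_ring}) : Prop :=
  forall u v, u \in I -> qr_mul u v \in I.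

Definition simple_right_ideal (I : {vspace quandle_ring}) : Prop :=
  [/\ right_ideal I, I != 0%VS
    & forall J, right_ideal J -> (J <= I)%VS -> J = 0%VS \/ J = I].

Definition qr_span (X : {set T}) : {vspace quandle_ring} :=
  <<[seq qr_basis x | x <- enum X]>>%VS.

(* The linear map sending each basis element x to p x. *)
Definition qr_perm (p : {perm T}) (u : quandle_ring) : quandle_ring :=
  [ffun y => u ((p^-1)%g y)].

End QuandleRing.

Section Takasaki.
Variable H : finZmodType.

Definition takasaki (a b : H) : H := b + b - a.

Fact takasaki_inj (x : H) : injective (takasaki^~ x).
Proof. by move=> a b /addrI /oppr_inj. Qed.

Definition rperm (x : H) : {perm H} := perm (@takasaki_inj x).

Definition inn : {group {perm H}} := <<[set rperm x | x : H]>>%G.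

(* restr_perm X p agrees with p on X and is the identity elsewhere, so this is
   the permutation group of X generated by the restrictions of the R_x. *)
Definition inn_orbit (X : {set H}) : {group {perm H}} :=
  <<[set restr_perm X (rperm x) | x : H]>>%G.

Definition doubles : {set H} := [set h + h | h : H].

(* The ambient group H ><| Z/2, where (h, b) stands for h s^b; Dih(2H) is the
   subgroup of the (h, b) with h in 2H. *)
Definition dih_ambient : Type := (H * bool)%type.
HB.instance Definition _ := Finite.on dih_ambient.

Definition dih_mul (g g' : dih_ambient) : dih_ambient :=
  (g.1 + (if g.2 then - g'.1 else g'.1), g.2 (+) g'.2).
Definition dih_inv (g : dih_ambient) : dih_ambient :=
  (if g.2 then g.1 else - g.1, g.2).

Fact dih_mulA : associative dih_mul.
Proof.
move=> [a x] [b y] [c z]; rewrite /dih_mul /= addbA.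
by case: x y => [] [] /=; rewrite ?opprD ?opprK !addrA.
Qed.
Fact dih_mul1 : left_id (0, false) dih_mul.
Proof. by move=> [a x]; rewrite /dih_mul /= add0r. Qed.
Fact dih_mulV : left_inverse (0, false) dih_inv dih_mul.
Proof. by move=> [a []]; rewrite /dih_mul /= ?subrr ?addNr. Qed.

HB.instance Definition _ :=
  Finite_isGroup.Build dih_ambient dih_mulA dih_mul1 dih_mulV.

Definition dih_s : dih_ambient := (0, true).

Definition dih_set : {set dih_ambient} := [set g | g.1 \in doubles].

Fact dih_group_set : group_set dih_set.
Proof.
have dblP (a : H) : a + a \in doubles by apply/imsetP; exists a.
have dD (a b : H) : a \in doubles -> b \in doubles -> a + b \in doubles.
  by move=> /imsetP[x _ ->] /imsetP[y _ ->]; rewrite addrACA.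
have dN (a : H) : a \in doubles -> - a \in doubles.
  by move=> /imsetP[x _ ->]; rewrite opprD.
apply/group_setP; split=> [|[a x] [b y]]; rewrite !inE /=.
  by rewrite -[0](addr0 0).
by move=> da db; apply: (dD) => //; case: ifP => _ //; apply: dN.
Qed.
Canonical dih : {group dih_ambient} := Group dih_group_set.

Definition translation (h : H) : {perm H} := perm (addrI h).

(* R_x o R_0 is the translation by x + x; permutations compose from left to
   right. *)
Lemma translation_double (x : H) :
  translation (x + x) = (rperm 0 * rperm x)%g.
Proof.
by apply/permP=> y; rewrite permM !permE /takasaki addr0 sub0r opprK.
Qed.

(* The permutation of the orbit X = e + 2H attached to h s^b, namely
   y |-> h + R_e^b y. The translation by h commutes with the shift 2H -> X by e,
   which carries R_0 to R_e. *)
Definition dih_perm (X : {set H}) (e : H) (g : dih_ambient) : {perm H} :=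
  restr_perm X ((if g.2 then rperm e else 1) * translation g.1)%g.

(* dih_perm reverses products because permutations compose from left to right
   in the library: as functions, dih_perm (g * g') is the composite of
   dih_perm g after dih_perm g'. *)
Definition dih_identification (X : {set H}) (e : H) : Prop :=
  [/\ {in dih &, {morph dih_perm X e : g g' / (g * g')%g >-> (g' * g)%g}},
      {in dih &, injective (dih_perm X e)}
    & dih_perm X e @: dih = inn_orbit X].

Variable K : fieldType.

(* Matrices act on column vectors, and f is an intertwining isomorphism onto
   U. *)
Definition affords (X : {set H}) (e : H) (U : {vspace quandle_ring K H})
    (d : nat) (rG : mx_representation K dih d) : Prop :=
  exists f : 'Hom('cV[K]_d, quandle_ring K H),
    [/\ lker f = 0%VS, limg f = U
      & forall g v, g \in dih ->
          f (rG g *m v) = qr_perm (dih_perm X e g) (f v)].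

Definition enumerates_linear (m : nat)
    (phi : 'I_m -> mx_representation K dih 1) : Prop :=
  [/\ forall j, phi j dih_s = 1,
      forall j j', {in dih, phi j =1 phi j'} -> j = j'
    & forall rG : mx_representation K dih 1,
        rG dih_s = 1 -> exists j, {in dih, rG =1 phi j}].

Definition enumerates_irr2 (m : nat)
    (psi : 'I_m -> mx_representation K dih 2) : Prop :=
  [/\ forall j, mx_irreducible (psi j),
      forall j j', mx_rsim (psi j) (psi j') -> j = j'
    & forall rG : mx_representation K dih 2,
        mx_irreducible rG -> exists j, mx_rsim rG (psi j)].

End Takasaki.

Section OrbitLabels.
Variables (k k' d' : nat).
Variables (n : 'I_k -> nat) (n' : 'I_k' -> nat) (m' : 'I_d' -> nat).

Definition moduli (l : 'I_k + 'I_k' + 'I_d') : nat :=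
  match l with
  | inl (inl a) => (2 * n a)%N
  | inl (inr b) => (2 * n' b)%N
  | inr c => m' c
  end.

(* The binary digits of i, the most significant one for the first factor; the
   factors of odd order carry the symbol 0. *)
Definition label_digit (i : nat) (l : 'I_k + 'I_k' + 'I_d') : bool :=
  match l with
  | inl (inl a) => odd (i %/ 2 ^ (k + k' - a.+1))
  | inl (inr b) => odd (i %/ 2 ^ (k' - b.+1))
  | inr _ => false
  end.

Definition label (i : nat) : cyclic_prod moduli :=
  [ffun l => inZp (label_digit i l)].

Definition orbit_of (i : nat) : {set cyclic_prod moduli} :=
  orbit 'P (inn (cyclic_prod moduli)) (label i).

End OrbitLabels.

(* Main.v *)
Require Import Defs.
From HB Require Import structures.
From mathcomp Require Import all_boot all_order all_algebra all_fingroup.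
From mathcomp Require Import mxrepresentation complex reals.
From mathcomp Require Import separable cyclotomic cyclic ring zify.

Set Implicit Arguments.
Unset Strict Implicit.
Unset Printing Implicit Defensive.

Import Order.TTheory GRing.Theory Num.Theory.
Local Open Scope ring_scope.

(** Write D = 2H. On an orbit X = e + D the restriction of R_x sends e + z to e
    + 2(x - e) - z, so Inn(X) acts as z |-> h + z and z |-> h - z with h in D,
    which is Dih(D); the action is faithful because D has an element of order
    greater than two, i.e. because H is not a product of copies of Z/2 and Z/4.
    Moreover u . x is the image of u under R_x, so the right ideals of K[T]
    inside K[X] are exactly the subrepresentations of K[X].

    It remains to split the permutation representation of Dih(D) on the
    functions on D, which is Fourier analysis. A symmetric nondegenerate
    pairing H x H -> S^1 induces, for every u in D, a character chi_u of D, and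
    chi_u is real exactly when 2u = 0. Its real and imaginary parts cos_u and
    sin_u take values in R, hence in K for both choices of K, and all that is
    used about them are the parity and addition formulas, the symmetry in u and
    z, and the vanishing of sum_u cos_u(z) for z <> 0 (trig_pairing). The span
    of cos_u and sin_u is stable and affords the rotation representation
    rot_repr u when 2u <> 0 (affords_rot), or a degree one representation with
    s = 1 when 2u = 0 (affords_cos). Fourier inversion (wave_inversion) shows
    that these subspaces span K[X]; as cos_u, sin_u and cos_(-u), sin_(-u) span
    the same plane, the dimensions add up to |D|, so the sum is direct.

    The same transform classifies the representations: if w is an eigenvector
    of s in a representation and F is a function on D, the vectors w_F = sum_z
    F(z) w z transform under the group like the functions F, and inversion
    gives sum_u w_(cos_u) = |D| w. Hence some w_(cos_u) is nonzero, and with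
    w_(sin_u) it spans a copy of rot_repr u (irr2_rot), or shows that a degree
    one representation with s = 1 is some real chi_u (linear_rep_cos). So any
    given enumeration is, up to equivalence, u |-> cos_u over the u with 2u =
    0, respectively rot_repr over representatives of the pairs {u, -u} with 2u
    <> 0, and the decomposition above can be relabelled accordingly.

    For the group of the theorem the count of the u in D with 2u = 0 is 2^k
    (card_torsion2), and the orbits are told apart by the parities of the
    coordinates of even modulus, i.e. by the binary digits of the label
    (double_coset_parityP, label_cover, label_disjoint). *)

(** * The dihedral action on an orbit *)

Section DihedralAction.
Variable H : finZmodType.
Implicit Types (e h x y z : H) (g : dih_ambient H).

Local Notation D := (doubles H).

Lemma doublesP z : reflect (exists y, z = y + y) (z \in D).
Proof. by apply: (iffP imsetP) => [[y _ ->]|[y ->]]; exists y. Qed.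

Lemma mem_double y : y + y \in D.
Proof. by apply/doublesP; exists y. Qed.

Lemma doubles0 : 0 \in D.
Proof. by rewrite -[0]addr0 mem_double. Qed.

Lemma doublesD x y : x \in D -> y \in D -> x + y \in D.
Proof.
by move=> /doublesP[a ->] /doublesP[b ->]; rewrite addrACA mem_double.
Qed.

Lemma doublesN x : (- x \in D) = (x \in D).
Proof.
have dN y : y \in D -> - y \in D.
  by move=> /doublesP[a ->]; rewrite opprD mem_double.
by apply/idP/idP=> /dN //; rewrite opprK.
Qed.

Lemma doublesB x y : x \in D -> y \in D -> x - y \in D.
Proof. by move=> Dx Dy; rewrite doublesD ?doublesN. Qed.

Definition double_coset e : {set H} := [set y | y - e \in D].

Lemma double_cosetP e y :
  reflect (exists2 z, z \in D & y = e + z) (y \in double_coset e).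
Proof.
rewrite inE; apply: (iffP idP) => [Dz|[z Dz ->]].
  by exists (y - e); rewrite // addrC subrK.
by rewrite addrAC subrr add0r.
Qed.

Lemma rperm_double_coset e x y :
  (rperm x y \in double_coset e) = (y \in double_coset e).
Proof.
rewrite !inE permE /takasaki -[RHS]doublesN.
have -> : x + x - y - e = (x - e + (x - e)) - (y - e).
  by rewrite opprB -[RHS]addrA subrKA addrA [x - e + x]addrAC [RHS]addrAC.
apply/idP/idP=> [h|]; last by apply: doublesD; apply: mem_double.
by rewrite -[- _](addKr (x - e + (x - e))) doublesD // doublesN mem_double.
Qed.

(** As 2x - y - e = 2(x - e) - (y - e), every R_x preserves e + 2H; conversely
    R_e followed by R_(e + t) is the translation by 2t. *)
Lemma orbit_inn e : orbit 'P (inn H) e = double_coset e.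
Proof.
apply/setP=> y; apply/idP/idP=> [/orbitP[p]|].
  move=> inn_p <-; suff: p \in 'N(double_coset e | 'P)%g.
    by move/astabs_act=> ->; rewrite inE subrr doubles0.
  move: p inn_p; apply/subsetP; rewrite gen_subG;
    apply/subsetP=> _ /imsetP[x _ ->].
  by rewrite !inE; apply/subsetP=> y' ey';
    rewrite inE /= /aperm rperm_double_coset.
case/double_cosetP=> _ /doublesP[t ->] ->; apply/orbitP.
exists (rperm e * rperm (e + t))%g.
  by rewrite groupM // mem_gen //; apply/imsetP; eexists.
rewrite /= /aperm permM !permE /takasaki.
by rewrite addrK addrACA addrAC addrK.
Qed.

Variable e : H.
Local Notation X := (double_coset e).

Lemma dih_perm_stable g : g \in dih H ->
  (((if g.2 then rperm e else 1) * translation g.1)%g) \in 'N(X | 'P)%g.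
Proof.
rewrite inE => Dg; rewrite groupM //.
  case: ifP => // _; rewrite !inE; apply/subsetP=> y Xy.
  by rewrite inE /= /aperm rperm_double_coset.
rewrite !inE; apply/subsetP=> y; rewrite !inE /= /aperm permE -addrA => Dy.
exact: doublesD.
Qed.

Definition flip (b : bool) z := if b then - z else z.

Lemma dih_permE g y : g \in dih H ->
  dih_perm X e g y = if y \in X then e + (g.1 + flip g.2 (y - e)) else y.
Proof.
move=> Dg; rewrite /dih_perm; case: (boolP (y \in X)) => [Xy|nXy]; last first.
  by rewrite (out_perm (restr_perm_on _ _)).
rewrite restr_permE ?dih_perm_stable // permM [translation _ _]permE.
rewrite addrCA; congr (_ + _); case: g.2 => /=;
  last by rewrite perm1 addrC subrK.
by rewrite permE /takasaki opprB addrA.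
Qed.

Lemma dih_perm_coset g z : g \in dih H -> z \in D ->
  dih_perm X e g (e + z) = e + (g.1 + flip g.2 z).
Proof.
move=> Dg Dz; rewrite dih_permE // ifT; last by apply/double_cosetP; exists z.
by rewrite addrAC subrr add0r.
Qed.

Lemma flip_doubles b z : (flip b z \in D) = (z \in D).
Proof. by case: b; rewrite //= doublesN. Qed.

Lemma mem_dih g : (g \in dih H) = (g.1 \in D).
Proof. by rewrite inE. Qed.

Lemma dih_permM g g' : g \in dih H -> g' \in dih H ->
  dih_perm X e (g * g')%g = (dih_perm X e g' * dih_perm X e g)%g.
Proof.
move=> Dg Dg'; apply/permP=> y; rewrite permM.
have Dgg' := groupM Dg Dg'.
case: (boolP (y \in X)) => [/double_cosetP[z Dz ->]|nXy]; last first.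
  by rewrite !dih_permE ?(negPf nXy).
rewrite !dih_perm_coset //; last by rewrite doublesD ?flip_doubles // -mem_dih.
congr (e + _); case: g g' {Dg Dg' Dgg'} => [a b] [a' b'] /=.
by case: b b' => [] [] /=; rewrite ?opprD ?opprK addrA.
Qed.

Lemma rperm_dih x y : y \in X ->
  rperm x y = dih_perm X e (x - e + (x - e), true) y.
Proof.
case/double_cosetP=> z Dz ->; rewrite dih_perm_coset ?mem_dih ?mem_double //=.
rewrite permE /takasaki opprD !addrA; congr (_ - _).
by rewrite [e + x]addrC addrK.
Qed.

Lemma restr_rperm x :
  restr_perm X (rperm x) = dih_perm X e (x - e + (x - e), true).
Proof.
apply/permP=> y; case: (boolP (y \in X)) => Xy.
  rewrite -rperm_dih // restr_permE //.
  by rewrite !inE; apply/subsetP=> y' Xy';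
    rewrite inE /= /aperm rperm_double_coset.
by rewrite (out_perm (restr_perm_on _ _)) // dih_permE ?(negPf Xy) ?mem_dih
  ?mem_double.
Qed.

(** An element w of 2H with 2w <> 0 tells z |-> h + z from z |-> h - z, which
    makes the action faithful. The restrictions of the R_x are the reflections
    z |-> h - z, and the translation by h is the product of two of them. *)
Lemma dih_identification_coset :
  (exists2 z, z \in D & z + z != 0) -> dih_identification X e.
Proof.
move=> [w Dw w2]; split.
- by move=> g g' Dg Dg'; rewrite dih_permM.
- move=> [a b] [a' b'] Dg Dg' /permP eq_p.
  have := eq_p (e + 0); rewrite !dih_perm_coset ?doubles0 //=.
  have s0 c : flip c 0 = 0 :> H by case: c; rewrite //= oppr0.
  rewrite !s0 !addr0 => /addrI eq_a; congr (_, _) => //.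
  have := eq_p (e + w); rewrite !dih_perm_coset //= eq_a => /addrI/addrI.
  have nw : (w == - w) = false by rewrite -addr_eq0 (negPf w2).
  by case: b b' {Dg Dg' eq_p} => [] [] //= /eqP; rewrite ?nw // eq_sym nw.
apply/eqP; rewrite eqEsubset; apply/andP; split; last first.
  have gP : group_set (dih_perm X e @: dih H).
    apply/group_setP; split=> [|p q].
      apply/imsetP; exists 1%g => //; apply/permP=> y.
      rewrite dih_permE // perm1; case: ifP => //= _.
      by rewrite add0r addrC subrK.
    case/imsetP=> [g Dg ->] /imsetP[g' Dg' ->].
    by rewrite -dih_permM // imset_f // groupM.
  rewrite (@gen_subG _ _ (Group gP)); apply/subsetP=> _ /imsetP[x _ ->].
  by rewrite restr_rperm imset_f // mem_dih mem_double.
apply/subsetP=> _ /imsetP[g Dg ->].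
have tw a : a \in D -> dih_perm X e (a, true) \in inn_orbit X.
  case/doublesP=> t ->; rewrite -[t](addrK e) -restr_rperm.
  by apply/mem_gen/imsetP; exists (t + e).
case: g Dg => a [] Da; rewrite mem_dih /= in Da; first exact: tw.
have -> : (a, false) = (((a, true) : dih_ambient H) * dih_s H)%g.
  by congr (_, _); rewrite /= oppr0 addr0.
by rewrite dih_permM ?mem_dih ?doubles0 // groupM ?tw ?doubles0.
Qed.

End DihedralAction.

(** * Right ideals and representations *)

Section Irreducible.
Variables (gT : finGroupType) (G : {group gT}) (K : fieldType).

(** Irreducibility is a statement about row spaces, while vectors are columns
    here. The rows that annihilate the orbit of v form a submodule; it is proper
    since v <> 0, so it vanishes and the orbit spans. *)
Lemma irr_col_span d (rG : mx_representation K G d) (v : 'cV[K]_d) :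
    mx_irreducible rG -> v != 0 ->
  forall w, exists c : 'I_#|G| -> K, w = \sum_i c i *: (rG (enum_val i) *m v).
Proof.
move=> irrG nz_v w.
pose M := \matrix_(i < d, j < #|G|) (rG (enum_val j) *m v) i 0.
have colM y : M *m y = \sum_j y j 0 *: (rG (enum_val j) *m v).
  apply/colP=> i; rewrite mxE summxE; apply: eq_bigr => j _.
  by rewrite !mxE mulrC.
have entryM m (r : 'M_(m, d)) i j :
    (r *m M) i j = (r *m (rG (enum_val j) *m v)) i 0.
  by rewrite !mxE; apply: eq_bigr => l _; rewrite [M _ _]mxE.
have killM m (r : 'M_(m, d)) :
    r *m M = 0 <-> {in G, forall x, r *m (rG x *m v) = 0}.
  split=> [rM0 x Gx | rv0]; apply/matrixP=> i j; last first.
    by rewrite entryM rv0 ?enum_valP // !mxE.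
  by rewrite ord1 -(enum_rankK_in Gx Gx) -entryM rM0 !mxE.
suff /row_freeP[N MN]: row_free M.
  by exists (fun i => (N *m w) i 0); rewrite -colM mulmxA MN mul1mx.
have /mx_irrP[_ irr] := irrG; rewrite -kermx_eq0; apply: contraT => nz_ker.
have: row_full (kermx M).
  apply: irr => //; apply/mxmoduleP=> x Gx; apply/sub_kermxP;
    apply: (killM _ _).2 => y Gy.
  rewrite -mulmxA [rG x *m _]mulmxA -repr_mxM //.
  by apply: (killM _ _).1; rewrite ?groupM ?mulmx_ker.
rewrite -sub1mx => /sub_kermxP/(killM _ _).1/(_ 1%g (group1 G)).
by rewrite repr_mx1 !mul1mx => v0; rewrite v0 eqxx in nz_v.
Qed.

Lemma irr_linear (rG : mx_representation K G 1) : mx_irreducible rG.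
Proof.
apply/mx_irrP; split=> // U _ nzU.
by rewrite /row_full eqn_leq rank_leq_col lt0n mxrank_eq0.
Qed.
End Irreducible.

Section RightIdeals.
Variables (H : finZmodType) (K : fieldType).
Local Notation KT := (quandle_ring K H).
Local Notation D := (doubles H).
Implicit Types (u v : KT) (J : {vspace KT}) (e x y z : H).

Lemma qr_sum_basis (u : KT) : u = \sum_y (u y : K) *: qr_basis K y.
Proof.
apply/ffunP=> x; rewrite sum_ffunE (bigD1 x) //= big1 => [|y ne_yx].
  by rewrite !ffunE eqxx addr0 /GRing.scale /= mulr1.
by rewrite !ffunE (negPf ne_yx) /GRing.scale /= mulr0.
Qed.

Lemma qr_permM (p q : {perm H}) u :
  qr_perm (p * q)%g u = qr_perm q (qr_perm p u).
Proof. by apply/ffunP=> y; rewrite !ffunE invMg permM. Qed.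

Lemma qr_perm_sum (p : {perm H}) u :
  qr_perm p u = \sum_x (u x : K) *: qr_basis K (p x).
Proof.
rewrite [LHS]qr_sum_basis (reindex_inj (@perm_inj _ p)) /=.
by apply: eq_bigr => x _; rewrite !ffunE permK.
Qed.

Lemma takasaki_mulE u v :
  qr_mul (@takasaki H) u v = \sum_y (v y : K) *: qr_perm (rperm y) u.
Proof.
rewrite /qr_mul exchange_big; apply: eq_bigr => y _.
rewrite qr_perm_sum scaler_sumr; apply: eq_bigr => x _.
by rewrite scalerA mulrC permE.
Qed.

(** Right multiplication by the basis element x permutes the basis by R_x. *)
Lemma right_ideal_rperm J :
  right_ideal (@takasaki H) J <->
  forall x u, u \in J -> qr_perm (rperm x) u \in J.
Proof.
split=> [rJ x u Ju | rJ u v Ju]; last first.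
  by rewrite takasaki_mulE memv_suml // => y _; rewrite memvZ // rJ.
suff <- : qr_mul (@takasaki H) u (qr_basis K x) = qr_perm (rperm x) u.
  exact: rJ.
rewrite takasaki_mulE (bigD1 x) //= big1 => [|y ne_yx].
  by rewrite ffunE eqxx scale1r addr0.
by rewrite ffunE eq_sym (negPf ne_yx) scale0r.
Qed.

Lemma qr_spanP (X : {set H}) u :
  reflect (forall y, y \notin X -> u y = 0) (u \in qr_span K X).
Proof.
apply: (iffP idP) => [/coord_span-> y nXy | u0].
  rewrite sum_ffunE big1 // => i _; rewrite ffunE.
  have /mapP[x] : (map_tuple (@qr_basis K H) (enum_tuple X))`_i
      \in [seq qr_basis K x | x <- enum X].
    by apply: mem_nth; rewrite size_tuple.
  rewrite mem_enum => Xx ->.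
  by rewrite ffunE (_ : (x == y) = false) ?scaler0 //;
    apply: contraNF nXy => /eqP<-.
rewrite [u]qr_sum_basis memv_suml // => y _.
case: (boolP (y \in X)) => [Xy|/u0->]; last by rewrite scale0r mem0v.
by rewrite memvZ // memv_span // map_f // mem_enum.
Qed.

Lemma qr_perm_dih e x u : u \in qr_span K (double_coset e) ->
  qr_perm (rperm x) u
  = qr_perm (dih_perm (double_coset e) e (x - e + (x - e), true)) u.
Proof.
move=> /qr_spanP supp_u; rewrite !qr_perm_sum; apply: eq_bigr => y _.
case: (boolP (y \in double_coset e)) => [Xy|/supp_u->];
  last by rewrite !scale0r.
by rewrite (rperm_dih _ Xy).
Qed.

Variables (e : H) (d : nat) (U : {vspace KT}).
Local Notation X := (double_coset e).

Lemma affords_dim (rG : mx_representation K (dih H) d) :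
  affords X e U rG -> \dim U = d.
Proof.
case=> f [f0 <- _]; have := limg_ker_dim f fullv.
by rewrite capfv f0 dimv0 add0n dimvf dim_matrix mulr1.
Qed.

Lemma affords_rsim (rG rG' : mx_representation K (dih H) d) :
  mx_rsim rG rG' -> affords X e U rG' -> affords X e U rG.
Proof.
case=> B _; rewrite row_free_unit => uB simB [f [f0 fU f_int]].
pose b : 'Hom('cV[K]_d, 'cV[K]_d) := linfun (mulmx (invmx B)).
have bE (v : 'cV[K]_d) : b v = invmx B *m v by rewrite lfunE.
exists (f \o b)%VF; split=> [||g v Gg].
- have /lker0P injf : lker f == 0%VS by rewrite f0.
  apply/eqP/lker0P=> v w; rewrite !comp_lfunE !bE => /injf/(congr1 (mulmx B)).
  by rewrite !mulKVmx.
- rewrite -fU limg_comp; congr (_ @: _)%VS; apply/eqP; rewrite eqEsubv subvf /=.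
  by apply/subvP=> v _; rewrite -[v](mulKmx uB) -bE memv_img ?memvf.
- rewrite !comp_lfunE !bE -f_int //; congr (f _).
  rewrite mulmxA -[invmx B *m _](mulmxK uB) -[_ *m rG g *m B]mulmxA simB //.
  by rewrite mulKmx // mulmxA.
Qed.

(** An intertwiner identifies the right ideals inside U with subspaces stable
    under the reflections z |-> h - z, hence under all of Dih(2H), because the
    translations are products of reflections. *)
Lemma affords_simple (rG : mx_representation K (dih H) d) :
    mx_irreducible rG -> affords X e U rG -> (U <= qr_span K X)%VS ->
  simple_right_ideal (@takasaki H) U.
Proof.
move=> irrG affU sUX; have [f [f0 fU f_int]] := affU.
have Dx x : (x - e + (x - e), true) \in dih H by rewrite mem_dih mem_double.
split=> [|| J rJ sJU].
- apply/right_ideal_rperm=> x u Uu; rewrite (@qr_perm_dih e) ?(subvP sUX) //.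
  by move: Uu; rewrite -fU => /memv_imgP[v _ ->];
    rewrite -f_int ?memv_img ?memvf.
- by rewrite -dimv_eq0 (affords_dim affU) -lt0n; case/mx_irrP: irrG.
have [-> | nzJ] := eqVneq J 0%VS; [by left | right].
have J_rot g u : g \in dih H -> u \in J -> qr_perm (dih_perm X e g) u \in J.
  have J_refl a w : a \in D -> w \in J ->
      qr_perm (dih_perm X e (a, true)) w \in J.
    case/doublesP=> t -> Jw; rewrite -[t](addrK e) -qr_perm_dih.
      exact: (right_ideal_rperm J).1.
    by rewrite (subvP sUX) // (subvP sJU).
  case: g => a [] Da Ju; rewrite mem_dih /= in Da; first exact: J_refl.
  have -> : (a, false) = (((a, true) : dih_ambient H) * dih_s H)%g.
    by congr (_, _); rewrite /= oppr0 addr0.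
  rewrite dih_permM ?mem_dih ?doubles0 // qr_permM.
  by rewrite !J_refl ?doubles0.
apply/eqP; rewrite eqEsubv sJU /=; apply/subvP=> u; rewrite -{1}fU.
case/memv_imgP=> w _ ->; have nz0 : vpick J != 0 by rewrite vpick0.
have: vpick J \in limg f by rewrite fU (subvP sJU) ?memv_pick.
case/memv_imgP=> v _ Jv; have nzv : v != 0.
  by apply: contraNneq nz0 => v0; rewrite Jv v0 linear0.
have [c ->] := irr_col_span irrG nzv w.
rewrite linear_sum memv_suml // => i _; rewrite linearZ memvZ //=.
by rewrite f_int ?enum_valP // -Jv J_rot ?enum_valP ?memv_pick.
Qed.

End RightIdeals.

(** * Trigonometric functions on a finite abelian group *)

(** cs u and sn u stand for the real and imaginary parts of the character chi_u
    of H obtained from a symmetric pairing b by chi_u(z) = b(v, z) for some v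
    with 2v = u. On 2H the choice of v is immaterial, which is why the laws
    that move the variable u are required there only; the laws in z hold for
    every u, so that the rotation representation below makes sense for every
    u. *)
Record trig_pairing (H : finZmodType) (K : fieldType) (cs sn : H -> H -> K) :
    Prop := TrigPairing {
  trig_pchar : [pchar K] =i pred0;
  cos0 : forall u, cs u 0 = 1;
  cosN : forall u z, cs u (- z) = cs u z;
  sinN : forall u z, sn u (- z) = - sn u z;
  cosD : forall u z w, cs u (z + w) = cs u z * cs u w - sn u z * sn u w;
  sinD : forall u z w, sn u (z + w) = sn u z * cs u w + cs u z * sn u w;
  cosC : {in doubles H &, forall u z, cs u z = cs z u};
  sinC : {in doubles H &, forall u z, sn u z = sn z u};
  sum_cos : forall z, z \in doubles H -> z != 0 ->
    \sum_(u in doubles H) cs u z = 0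
}.

Section Trig.
Variables (H : finZmodType) (K : fieldType) (cs sn : H -> H -> K).
Hypothesis trig : trig_pairing cs sn.
Local Notation D := (doubles H).
Implicit Types (u v z w e : H).

Lemma natK_neq0 n : (0 < n)%N -> n%:R != 0 :> K.
Proof. by move: (trig_pchar trig) => /pcharf0P->; rewrite -lt0n. Qed.

Lemma two_neq0 : 2%:R != 0 :> K.
Proof. exact: natK_neq0. Qed.

Lemma eq_opp_eq0 (a : K) : a = - a -> a = 0.
Proof.
move/eqP; rewrite -addr_eq0 -mulr2n -mulr_natl mulf_eq0 (negPf two_neq0) /=.
by move/eqP.
Qed.

Lemma sin0 u : sn u 0 = 0.
Proof. by apply: eq_opp_eq0; rewrite -(sinN trig) oppr0. Qed.

Lemma cosB u z w : cs u (z - w) = cs u z * cs u w + sn u z * sn u w.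
Proof. by rewrite (cosD trig) (cosN trig) (sinN trig) mulrN opprK. Qed.

Lemma sinB u z w : sn u (z - w) = sn u z * cs u w - cs u z * sn u w.
Proof. by rewrite (sinD trig) (cosN trig) (sinN trig) mulrN. Qed.

Lemma cos_swap u z : u \in D -> z \in D -> cs u z = cs z u.
Proof. by move=> Du Dz; rewrite (cosC trig). Qed.

Lemma sin_swap u z : u \in D -> z \in D -> sn u z = sn z u.
Proof. by move=> Du Dz; rewrite (sinC trig). Qed.

Lemma cosNl u z : u \in D -> z \in D -> cs (- u) z = cs u z.
Proof. by move=> Du Dz; rewrite !(cos_swap _ Dz) ?doublesN ?(cosN trig). Qed.

Lemma sinNl u z : u \in D -> z \in D -> sn (- u) z = - sn u z.
Proof. by move=> Du Dz; rewrite !(sin_swap _ Dz) ?doublesN ?(sinN trig). Qed.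

Lemma card_doubles_neq0 : #|D|%:R != 0 :> K.
Proof. by apply: natK_neq0; apply/card_gt0P; exists 0; apply: doubles0. Qed.

Lemma sum_cosE z : z \in D ->
  \sum_(u in D) cs u z = if z == 0 then #|D|%:R else 0.
Proof.
move=> Dz; have [-> | nz] := eqVneq z 0; last exact: (sum_cos trig).
under eq_bigr do rewrite (cos0 trig).
by rewrite sumr_const.
Qed.

Lemma sum_cos_dual u : u \in D ->
  \sum_(z in D) cs u z = if u == 0 then #|D|%:R else 0.
Proof.
by move=> Du; rewrite -sum_cosE //; apply: eq_bigr => z Dz; rewrite cos_swap.
Qed.

(** If sin_u vanishes on 2H then cos_u^2 = 1 there, so cos_(u + u) is the
    constant 1, whose sum over 2H is not zero. *)
Lemma sin_eq0 u : u \in D -> (forall z, z \in D -> sn u z = 0) -> u + u = 0.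
Proof.
move=> Du su0; apply/eqP/negP => /negP nz.
have := sum_cos_dual (doublesD Du Du); rewrite (negPf nz).
rewrite (eq_bigr (fun=> 1)) => [|z Dz]; last first.
  rewrite cos_swap ?doublesD // (cosD trig).
  rewrite -!(sin_swap Du Dz) -!(cos_swap Du Dz).
  by rewrite su0 // mulr0 subr0; have := cosB u z z;
    rewrite subrr (cos0 trig) su0 // mulr0 addr0 => <-.
by rewrite sumr_const => /eqP; rewrite (negPf card_doubles_neq0).
Qed.

Lemma sin_torsion u z : u \in D -> z \in D -> u + u = 0 -> sn u z = 0.
Proof.
move=> Du Dz /eqP; rewrite addr_eq0 => /eqP uN.
by apply: eq_opp_eq0; rewrite -sinNl // -uN.
Qed.

Lemma sin_neq0 u : u \in D -> u + u != 0 -> exists2 z, z \in D & sn u z != 0.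
Proof.
move=> Du u2; case: (pickP [pred z in D | sn u z != 0]) => [z /andP[Dz nz]|su0].
  by exists z.
case/eqP: u2; apply: sin_eq0 => // z Dz; apply/eqP.
by have := su0 z; rewrite /= Dz /= => /negbFE.
Qed.

Lemma cos_inj u v : u \in D -> v \in D ->
  (forall z, z \in D -> cs u z = cs v z) -> v = u \/ v = - u.
Proof.
move=> Du Dv euv.
have [-> | ne] := eqVneq v u; first by left.
have [-> | neN] := eqVneq v (- u); first by right.
(* The function 2 cos_u cos_v = cos_(u + v) + cos_(u - v) has mean zero on D,
   while 2 cos_u^2 = 1 + cos_(u + u) has mean 1 or 2. *)
have prodE w z : w \in D -> z \in D ->
    cs u z * cs w z *+ 2 = cs (u + w) z + cs (u - w) z.
  move=> Dw Dz; rewrite !(cos_swap _ Dz) ?doublesD ?doublesN //.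
  by rewrite (cosD trig) cosB mulr2n addrACA addNr addr0.
have: \sum_(z in D) (cs u z * cs v z *+ 2) = 0.
  rewrite (eq_bigr _ (fun z Dz => prodE v z Dv Dz)) big_split /=.
  rewrite !sum_cos_dual ?doublesD ?doublesN //.
  by rewrite addr_eq0 subr_eq0 [u == v]eq_sym (negPf ne) -eqr_oppLR eq_sym
    (negPf neN) addr0.
rewrite (eq_bigr (fun z => cs u z * cs u z *+ 2)) => [|z Dz];
  last by rewrite -euv.
rewrite (eq_bigr _ (fun z Dz => prodE u z Du Dz)) big_split /=.
rewrite !sum_cos_dual ?doublesD ?doublesN // subrr eqxx.
case: ifP => _ /eqP; rewrite ?add0r ?(negPf card_doubles_neq0) //.
rewrite -mulr2n -[_ *+ 2]mulr_natl mulf_eq0.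
by rewrite (negPf two_neq0) (negPf card_doubles_neq0).
Qed.

Section Rotation.
Variable u : H.

(** The rotation by chi_u(h) times diag(1, -1)^b, for g = h s^b. *)
Definition rot_mx (g : dih_ambient H) : 'M[K]_2 :=
  \matrix_(i, j) if j == 0 then (if i == 0 then cs u g.1 else sn u g.1)
                 else (-1) ^+ g.2 * (if i == 0 then - sn u g.1 else cs u g.1).

Lemma rot_mx_repr : mx_repr (dih H) rot_mx.
Proof.
split=> [|[a b] [a' b'] _ _]; apply/matrixP=> i j.
  rewrite !mxE /= (cos0 trig) sin0 oppr0 mul1r.
  by case: i j => [[|[|//]] ?] [[|[|//]] ?].
rewrite !mxE !big_ord_recl big_ord0 !mxE /= addr0.
case: i j => [[|[|//]] ?] [[|[|//]] ?];
  case: b b' => [] [] /=; rewrite -?signr_addb /= ?expr0 ?expr1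
    ?(cosD trig) ?(sinD trig) ?(cosN trig) ?(sinN trig); ring.
Qed.

Canonical rot_repr := MxRepresentation rot_mx_repr.

(** If r is a row of a submodule, r + r s and r - r s isolate its two
    coordinates, so a nonzero submodule contains a coordinate vector; a rotation
    with nonzero sine then gives the other one. *)
Lemma rot_irr : u \in D -> u + u != 0 -> mx_irreducible rot_repr.
Proof.
move=> Du u2; have [h Dh sh] := sin_neq0 Du u2.
apply/mx_irrP; split=> // U /mxmoduleP modU nzU; rewrite -sub1mx.
pose d0 : 'rV[K]_2 := delta_mx 0 0; pose d1 : 'rV[K]_2 := delta_mx 0 1.
suff [U0 U1]: (d0 <= U)%MS /\ (d1 <= U)%MS.
  apply/row_subP=> i; rewrite rowE mulmx1.
  by case: i => [[|[|//]] i]; [have -> : Ordinal i = 0 by apply/val_inj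
                              | have -> : Ordinal i = 1 by apply/val_inj].
have Umod (r : 'rV_2) g : g \in dih H -> (r <= U)%MS -> (r *m rot_mx g <= U)%MS.
  by move=> Dg rU; apply: submx_trans (submxMr _ rU) (modU g Dg).
have Dg : ((h, false) : dih_ambient H) \in dih H by rewrite mem_dih.
have U01 : (d0 <= U)%MS -> (d1 <= U)%MS.
  move=> U0.
  have -> : d1 = (sn u h)^-1 *: (cs u h *: d0 - d0 *m rot_mx (h, false)).
    apply/rowP=> j; rewrite !mxE !big_ord_recl big_ord0 !mxE /=.
    by case: j => [[|[|//]] ?] /=; field.
  by rewrite scalemx_sub // addmx_sub ?eqmx_opp ?Umod // scalemx_sub.
have U10 : (d1 <= U)%MS -> (d0 <= U)%MS.
  move=> U1.
  have -> : d0 = (sn u h)^-1 *: (d1 *m rot_mx (h, false) - cs u h *: d1).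
    apply/rowP=> j; rewrite !mxE !big_ord_recl big_ord0 !mxE /=.
    by case: j => [[|[|//]] ?] /=; field.
  by rewrite scalemx_sub // addmx_sub ?eqmx_opp ?Umod // scalemx_sub.
suff: (d0 <= U)%MS \/ (d1 <= U)%MS by case=> [U0|U1]; split; auto.
have /rowV0Pn[r rU nzr] := nzU.
have Ds : dih_s H \in dih H by rewrite mem_dih doubles0.
have nz2 := two_neq0.
have rE : r = r 0 0 *: d0 + r 0 1 *: d1.
  by apply/rowP=> j; rewrite !mxE; case: j => [[|[|//]] j] /=;
    rewrite ?mulr0 ?mulr1 ?addr0 ?add0r; congr (r _ _); apply/val_inj.
have rs : r *m rot_mx (dih_s H) = r 0 0 *: d0 - r 0 1 *: d1.
  apply/rowP=> j; rewrite {1}rE !mxE !big_ord_recl big_ord0 !mxE /=.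
  rewrite (cos0 trig) sin0.
  by case: j => [[|[|//]] ?] /=; ring.
have [r0 | nzr0] := eqVneq (r 0 0) 0.
  have nzr1 : r 0 1 != 0.
    by apply: contraNneq nzr => r1; rewrite rE r0 r1 !scale0r addr0.
  right; have -> : d1 = (r 0 1)^-1 *: r.
    by rewrite {2}rE r0 scale0r add0r scalerK.
  by rewrite scalemx_sub.
left; have -> : d0 = (r 0 0 *+ 2)^-1 *: (r + r *m rot_mx (dih_s H)).
  rewrite rs {2}rE addrACA subrr addr0 -scalerDl scalerA -mulr2n.
  by rewrite mulVf ?scale1r // -mulr_natl mulf_neq0.
by rewrite scalemx_sub // addmx_sub ?Umod.
Qed.
End Rotation.

Section Transform.
Variables (d : nat) (rG : mx_representation K (dih H) d).
Variables (w : 'rV[K]_d) (eps : K).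
Hypothesis w_eigen : w *m rG (dih_s H) = eps *: w.

Definition rot_of z : dih_ambient H := (z, false).

Lemma rot_of_dih z : (rot_of z \in dih H) = (z \in D).
Proof. by rewrite mem_dih. Qed.

Lemma dih_s_mem : dih_s H \in dih H.
Proof. by rewrite mem_dih doubles0. Qed.

(** The image of w under the element sum_z F(z) z of the group algebra. *)
Definition transform (F : H -> K) : 'rV_d :=
  \sum_(z in D) F z *: (w *m rG (rot_of z)).

Lemma transform_translate F h : h \in D ->
  transform F *m rG (rot_of h) = transform (fun z => F (z - h)).
Proof.
move=> Dh; rewrite /transform mulmx_suml [RHS](reindex_inj (addIr h)) /=.
apply: eq_big => [z | z Dz].
  apply/idP/idP=> [Dz | Dzh]; first exact: doublesD.
  by rewrite -(addrK h z) doublesB.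
by rewrite addrK -scalemxAl -mulmxA -repr_mxM ?rot_of_dih.
Qed.

(** In Dih(2H) one has z s = s (- z), and w is an eigenvector of s. *)
Lemma transform_reflect F :
  transform F *m rG (dih_s H) = eps *: transform (fun z => F (- z)).
Proof.
rewrite /transform mulmx_suml scaler_sumr [RHS](reindex_inj oppr_inj) /=.
apply: eq_big => [z | z Dz]; first by rewrite doublesN.
have comm_s : (rot_of z * dih_s H)%g = (dih_s H * rot_of (- z))%g.
  by congr (_, _); rewrite /= opprK addr0 add0r.
rewrite opprK -scalemxAl -mulmxA -repr_mxM ?rot_of_dih ?dih_s_mem // comm_s.
rewrite repr_mxM ?rot_of_dih ?dih_s_mem ?doublesN // mulmxA w_eigen.
by rewrite -scalemxAl !scalerA mulrC.
Qed.

Lemma transformD F1 F2 a b :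
  transform (fun z => a * F1 z + b * F2 z)
  = a *: transform F1 + b *: transform F2.
Proof.
rewrite /transform !scaler_sumr -big_split; apply: eq_bigr => z _.
by rewrite scalerDl !scalerA.
Qed.

Lemma eq_transform F1 F2 : F1 =1 F2 -> transform F1 = transform F2.
Proof. by move=> eqF; apply: eq_bigr => z _; rewrite eqF. Qed.

Lemma cos_translate u h : h \in D -> transform (cs u) *m rG (rot_of h)
  = cs u h *: transform (cs u) + sn u h *: transform (sn u).
Proof.
move=> Dh; rewrite transform_translate // -transformD.
by apply: eq_transform => z; rewrite cosB mulrC [sn u h * _]mulrC.
Qed.

Lemma sin_translate u h : h \in D -> transform (sn u) *m rG (rot_of h)
  = cs u h *: transform (sn u) - sn u h *: transform (cs u).
Proof.
move=> Dh; rewrite transform_translate // -scaleNr -transformD.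
by apply: eq_transform => z; rewrite sinB mulrC mulNr [sn u h * _]mulrC.
Qed.

Lemma cos_reflect u :
  transform (cs u) *m rG (dih_s H) = eps *: transform (cs u).
Proof.
rewrite transform_reflect; congr (_ *: _).
by apply: eq_transform => z; rewrite (cosN trig).
Qed.

Lemma sin_reflect u :
  transform (sn u) *m rG (dih_s H) = - eps *: transform (sn u).
Proof.
rewrite transform_reflect /transform !scaler_sumr; apply: eq_bigr => z _.
by rewrite (sinN trig) scaleNr scalerN scaleNr.
Qed.

(** The sum of the cos_u(z) over u kills every z <> 0, and w itself is the
    term z = 0. *)
Lemma transform_inversion : \sum_(u in D) transform (cs u) = #|D|%:R *: w.
Proof.
rewrite exchange_big (bigD1 0) ?doubles0 //=.
rewrite [X in _ + X]big1 => [|z /andP[Dz nz]].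
  by rewrite -scaler_suml sum_cosE ?doubles0 // eqxx repr_mx1 mulmx1 addr0.
by rewrite -scaler_suml sum_cosE // (negPf nz) scale0r.
Qed.

Lemma cos_transform_neq0 : w != 0 ->
  exists2 u, u \in D & transform (cs u) != 0.
Proof.
move=> nzw.
case: (pickP [pred u in D | transform (cs u) != 0]) => [u /andP[]|no_u].
  by exists u.
have := transform_inversion; rewrite big1 => [/esym/eqP|u Du]; last first.
  by have := no_u u; rewrite /= Du /= => /negbFE/eqP.
by rewrite scaler_eq0 (negPf nzw) (negPf card_doubles_neq0).
Qed.

End Transform.

(** Take for w the unit vector and u with w_(cos_u) <> 0. As s = 1, the vector
    w_(sin_u), which s negates, is zero; then h acts on w_(cos_u) by cos_u(h),
    and the equation for w_(sin_u) forces sin_u to vanish. *)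
Lemma linear_rep_cos (rG : mx_representation K (dih H) 1) :
    rG (dih_s H) = 1 ->
  exists u,
    [/\ u \in D, u + u = 0 & {in dih H, forall g, rG g = (cs u g.1)%:M}].
Proof.
move=> rGs; have w_eigen : (1 : 'rV[K]_1) *m rG (dih_s H) = 1 *: 1.
  by rewrite rGs mulmx1 scale1r.
have [|u Du nzC] := cos_transform_neq0 rG (w := 1); first exact: oner_neq0.
set C := transform rG 1 (cs u) in nzC; set S := transform rG 1 (sn u).
have S0 : S = 0.
  have := sin_reflect w_eigen u; rewrite rGs mulmx1 scaleN1r -/S => /matrixP SN.
  by apply/matrixP=> i j; rewrite [RHS]mxE; apply: eq_opp_eq0;
    rewrite {1}SN mxE.
have rC h : h \in D -> rG (rot_of h) = (cs u h)%:M.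
  move=> Dh; have := cos_translate rG 1 u Dh; rewrite -/C -/S S0 scaler0 addr0.
  rewrite -[cs u h *: C]mul_mx_scalar => eqC; apply/eqP; rewrite -subr_eq0.
  have /eqP := subrr (C *m rG (rot_of h)); rewrite {2}eqC -mulmxBr.
  rewrite [rG _ - _]mx11_scalar mul_mx_scalar scaler_eq0 (negPf nzC) orbF.
  by move/eqP->; rewrite raddf0.
exists u; split=> // [|[h b] Dg].
  apply: sin_eq0 => // h Dh; have := sin_translate rG 1 u Dh.
  rewrite -/C -/S S0 mul0mx scaler0 add0r => /eqP.
  by rewrite eq_sym oppr_eq0 scaler_eq0 (negPf nzC) orbF => /eqP.
rewrite mem_dih /= in Dg *; case: b; last exact: rC.
have -> : (h, true) = (rot_of h * dih_s H)%g by congr (_, _); rewrite /= addr0.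
by rewrite repr_mxM ?rot_of_dih ?dih_s_mem // rGs mulmx1 rC.
Qed.

(** As s is an involution, it fixes w0 + w0 s; if this is zero, it negates
    w0. *)
Lemma reflection_eigenvector d (rG : mx_representation K (dih H) d) :
    (0 < d)%N -> exists (w : 'rV[K]_d) (b : bool),
  w != 0 /\ w *m rG (dih_s H) = (-1) ^+ b *: w.
Proof.
case: d rG => // d rG _; pose w0 : 'rV[K]_d.+1 := delta_mx 0 0.
have nzw0 : w0 != 0.
  by apply/eqP=> /matrixP/(_ 0 0)/eqP; rewrite !mxE eqxx oner_eq0.
have [w1 | nzw1] := eqVneq (w0 + w0 *m rG (dih_s H)) 0; last first.
  exists (w0 + w0 *m rG (dih_s H)), false; split=> //.
  rewrite mulmxDl -mulmxA -repr_mxM ?dih_s_mem //.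
  have -> : (dih_s H * dih_s H)%g = 1%g by congr (_, _); rewrite /= subr0.
  by rewrite repr_mx1 mulmx1 expr0 scale1r addrC.
exists w0, true; split=> //; apply/eqP.
by rewrite expr1 scaleN1r -addr_eq0 addrC w1.
Qed.

(** Let w s = (-1)^b w and w_(cos_u) <> 0. The rows (w_(cos_u), - w_(sin_u))
    for b = 0, and (w_(sin_u), w_(cos_u)) for b = 1, transform under Dih(2H) by
    rot_mx u. They span a nonzero submodule, which is everything by
    irreducibility, so the change of basis is invertible; if u + u = 0 then
    w_(sin_u) = 0 and they would span at most a line. *)
Lemma irr2_rot (rG : mx_representation K (dih H) 2) : mx_irreducible rG ->
  exists u, [/\ u \in D, u + u != 0 & mx_rsim rG (rot_repr u)].
Proof.
move=> irrG; have [w [b [nzw w_eigen]]] := reflection_eigenvector rG isT.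
have [u Du nzC] := cos_transform_neq0 rG nzw.
set C := transform rG w (cs u) in nzC; set S := transform rG w (sn u).
pose p := if b then S else C; pose q := if b then C else - S.
pose M : 'M[K]_2 := col_mx p q.
have row0 : row 0 M = p.
  by apply/rowP=> j; rewrite mxE -(col_mxEu p q); congr (M _ _); apply/val_inj.
have row1 : row 1 M = q.
  by apply/rowP=> j; rewrite mxE -(col_mxEd p q); congr (M _ _); apply/val_inj.
have pq_rot h : h \in D -> p *m rG (rot_of h) = cs u h *: p - sn u h *: q /\
                           q *m rG (rot_of h) = sn u h *: p + cs u h *: q.
  move=> Dh; rewrite /p /q; case: (b);
    rewrite ?mulNmx cos_translate ?sin_translate //.
    by split=> //; rewrite addrC.
  by rewrite !scalerN opprK opprB.
have pq_s : p *m rG (dih_s H) = p /\ q *m rG (dih_s H) = - q.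
  rewrite /p /q; case: (b) w_eigen => w_eigen;
    rewrite ?mulNmx (cos_reflect w_eigen) (sin_reflect w_eigen).
    by rewrite expr1 opprK scale1r scaleN1r.
  by rewrite expr0 scale1r scaleN1r.
have M_rows (A : 'M[K]_2) (B : 'M[K]_2) :
    A 0 0 *: p + A 0 1 *: q = p *m B -> A 1 0 *: p + A 1 1 *: q = q *m B ->
  A *m M = M *m B.
  move=> e0 e1; apply/row_matrixP=> i; rewrite !row_mul mulmx_sum_row.
  rewrite !big_ord_recl big_ord0 addr0 !mxE.
  have -> : lift ord0 ord0 = 1 :> 'I_2 by apply/val_inj.
  rewrite row0 row1; case: i => [[|[|//]] i].
    by rewrite (_ : Ordinal i = 0) ?row0 //; apply/val_inj.
  by rewrite (_ : Ordinal i = 1) ?row1 //; apply/val_inj.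
have intM : {in dih H, forall g, rot_repr u g *m M = M *m rG g}.
  have intMr h : h \in D -> rot_mx u (rot_of h) *m M = M *m rG (rot_of h).
    move=> Dh; have [ep eq] := pq_rot h Dh.
    apply: M_rows; rewrite !mxE /= ?ep ?eq expr0 !mul1r //.
    by rewrite scaleNr.
  have intMs : rot_mx u (dih_s H) *m M = M *m rG (dih_s H).
    have [ep eq] := pq_s; apply: M_rows;
      rewrite !mxE /= ?ep ?eq (cos0 trig) sin0.
      by rewrite scale1r oppr0 mulr0 scale0r addr0.
    by rewrite scale0r add0r expr1 mulr1 scaleN1r.
  case=> h [] Dg; rewrite mem_dih /= in Dg; last exact: intMr.
  have -> : (h, true) = (rot_of h * dih_s H)%g by congr (_, _);
    rewrite /= addr0.
  by rewrite !repr_mxM ?rot_of_dih ?dih_s_mem // mulmxA -intMr // -!mulmxA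
    intMs.
have freeM : row_free M.
  have [_ irr] := (mx_irrP rG).1 irrG; rewrite row_free_unit -row_full_unit.
  apply: irr; first by apply/mxmoduleP=> g Dg; rewrite -intM ?submxMl.
  apply: contraNneq nzC => M0; apply/eqP.
  by move: row0 row1; rewrite M0 !row0 /p /q; case: (b).
exists u; split=> //; last by apply: mx_rsim_sym; exists M.
apply: contraTneq freeM => u2; have S0 : S = 0.
  by apply: big1 => z Dz; rewrite sin_torsion // scale0r.
apply/negP=> /row_free_inj injM.
have [i Mi0] : exists i, row i M = 0.
  by exists (if b then 0 else 1); move: row0 row1; rewrite /p /q S0 oppr0;
    case: (b).
have: (delta_mx 0 i : 'rV[K]_2) = 0 by apply: injM; rewrite -rowE Mi0 mul0mx.
by move/matrixP/(_ 0 i)/eqP; rewrite !mxE !eqxx oner_eq0.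
Qed.

End Trig.

(** * Waves on an orbit *)

Section AffordsBasis.
Variables (H : finZmodType) (K : fieldType).
Local Notation KT := (quandle_ring K H).

Lemma qr_perm_comb (I : finType) (p : {perm H}) (c : I -> K) (B : I -> KT) :
  qr_perm p (\sum_i c i *: B i) = \sum_i c i *: qr_perm p (B i).
Proof.
apply/ffunP=> y; rewrite ffunE !sum_ffunE; apply: eq_bigr => i _.
by rewrite !ffunE.
Qed.

(** As group elements act on columns, column j of rG g must list the coordinates
    of the image of the j-th basis vector. *)
Lemma affords_basis e d (rG : mx_representation K (dih H) d) (B : 'I_d -> KT) :
    (forall v : 'cV_d, \sum_i v i 0 *: B i = 0 -> v = 0) ->
    (forall g j, g \in dih H ->
       qr_perm (dih_perm (double_coset e) e g) (B j)
       = \sum_i rG g i j *: B i) ->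
  affords (double_coset e) e (\sum_i <[B i]>) rG.
Proof.
move=> freeB rotB; pose f0 (v : 'cV[K]_d) : KT := \sum_i v i 0 *: B i.
have f0_lin : linear f0.
  move=> a v w; rewrite /f0 scaler_sumr -big_split; apply: eq_bigr => i _.
  by rewrite !mxE scalerDl scalerA.
pose f0L : {linear 'cV[K]_d -> KT} :=
  HB.pack f0 (GRing.isLinear.Build _ _ _ _ f0 f0_lin).
have fE v : linfun f0L v = \sum_i v i 0 *: B i by rewrite lfunE.
exists (linfun f0L); split=> [||g v Dg].
- apply/eqP/lker0P=> v w fvw; apply/eqP; rewrite -subr_eq0; apply/eqP/freeB.
  by rewrite -fE linearB /= fvw subrr.
- apply/eqP; rewrite eqEsubv; apply/andP; split.
    apply/subvP=> _ /memv_imgP[v _ ->]; rewrite fE memv_sumr // => i _.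
    by rewrite memvZ // memv_line.
  apply/subv_sumP=> i _; rewrite -memvE; apply/memv_imgP.
  exists (delta_mx i 0); rewrite ?memvf // fE (bigD1 i) //= big1 => [|j ne_ji].
    by rewrite mxE !eqxx scale1r addr0.
  by rewrite mxE (negPf ne_ji) scale0r.
rewrite !fE qr_perm_comb (eq_bigr _ (fun j _ => congr1 _ (rotB g j Dg))).
under [RHS]eq_bigr do rewrite scaler_sumr.
rewrite exchange_big; apply: eq_bigr => i _; rewrite mxE scaler_suml.
by apply: eq_bigr => j _; rewrite scalerA mulrC.
Qed.
End AffordsBasis.

Section Waves.
Variables (H : finZmodType) (K : fieldType) (cs sn : H -> H -> K).
Hypothesis trig : trig_pairing cs sn.
Local Notation KT := (quandle_ring K H).
Local Notation D := (doubles H).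
Implicit Types (u v z w e : H).

Definition wave e (F : H -> K) : KT :=
  [ffun y => if y \in double_coset e then F (y - e) else 0].

Lemma waveE e F z : z \in D -> wave e F (e + z) = F z.
Proof.
move=> Dz; rewrite ffunE ifT; last by apply/double_cosetP; exists z.
by rewrite addrAC subrr add0r.
Qed.

Lemma wave_supp e F : wave e F \in qr_span K (double_coset e).
Proof. by apply/qr_spanP=> y nXy; rewrite ffunE (negPf nXy). Qed.

Lemma wave_ext e F1 F2 : {in D, F1 =1 F2} -> wave e F1 = wave e F2.
Proof.
by move=> eqF; apply/ffunP=> y; rewrite !ffunE inE; case: ifP => // /eqF.
Qed.

Lemma waveD e F1 F2 (a b : K) :
  wave e (fun z => a * F1 z + b * F2 z) = a *: wave e F1 + b *: wave e F2.
Proof.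
apply/ffunP=> y; rewrite !ffunE; case: ifP => // _.
by rewrite !scaler0 addr0.
Qed.

Lemma qr_perm_wave e F g : g \in dih H ->
  qr_perm (dih_perm (double_coset e) e g) (wave e F)
  = wave e (fun z => F (flip g.2 (z - g.1))).
Proof.
move=> Dg; apply/ffunP=> y; rewrite ffunE.
set p := dih_perm _ e g; set x := (p^-1)%g y.
have -> : y = p x by rewrite /x permKV.
case: (boolP (x \in double_coset e)) => [/double_cosetP[z Dz ->]|nXx].
  rewrite /p dih_perm_coset // !waveE ?doublesD ?flip_doubles -?mem_dih //.
  by congr F; rewrite addrAC subrr add0r; case: g.2; rewrite //= opprK.
by rewrite !ffunE /p dih_permE // !(negPf nXx).
Qed.

Lemma affords_cos e u (rG : mx_representation K (dih H) 1) :
    u \in D -> u + u = 0 -> {in dih H, forall g, rG g = (cs u g.1)%:M} ->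
  affords (double_coset e) e <[wave e (cs u)]> rG.
Proof.
move=> Du u2 rGE.
have := @affords_basis H K e 1 rG (fun _ => wave e (cs u)).
rewrite big_ord1; apply=> [v|g j Dg]; rewrite big_ord1.
  move/ffunP/(_ (e + 0)); rewrite ffunE [wave _ _ _]waveE ?doubles0 //.
  rewrite (cos0 trig) ffunE /GRing.scale /= mulr1 => v0.
  by apply/matrixP=> i j; rewrite !ord1 v0 mxE.
rewrite qr_perm_wave // rGE // !ord1 mxE mulr1n.
rewrite -[RHS]addr0 -(scale0r (wave e (cs u))) -waveD; apply: wave_ext => z Dz.
have Dg1 : g.1 \in D by rewrite -mem_dih.
have -> : cs u (flip g.2 (z - g.1)) = cs u (z - g.1).
  by case: g.2; rewrite //= (cosN trig).
by rewrite (cosB trig) (sin_torsion trig Du Dz u2) !mul0r !addr0 mulrC.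
Qed.

(** By the addition formulas a translation by h turns the pair (cos_u, sin_u) by
    chi_u(h), and s fixes cos_u and negates sin_u. *)
Lemma affords_rot e u : u \in D -> u + u != 0 ->
  affords (double_coset e) e (<[wave e (cs u)]> + <[wave e (sn u)]>)
    (rot_repr trig u).
Proof.
move=> Du u2; have lift1 : lift ord0 ord0 = 1 :> 'I_2 by apply/val_inj.
have := @affords_basis H K e 2 (rot_repr trig u)
  (fun i => wave e (if i == 0 then cs u else sn u)).
rewrite !big_ord_recl big_ord0 addv0 /=; apply=> [v|g j Dg];
  rewrite !big_ord_recl big_ord0 addr0 lift1 /=.
  rewrite -waveD => /ffunP v0.
  have v0E z : z \in D -> v 0 0 * cs u z + v 1 0 * sn u z = 0.
    by move=> Dz; have := v0 (e + z); rewrite [wave _ _ _]waveE // ffunE.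
  have v00 : v 0 0 = 0.
    have := v0E 0 (doubles0 H).
    by rewrite (cos0 trig) (sin0 trig) mulr0 addr0 mulr1.
  have [z Dz nz] := sin_neq0 trig Du u2.
  have v10 : v 1 0 = 0.
    by apply/eqP; move/eqP: (v0E z Dz);
      rewrite v00 mul0r add0r mulf_eq0 (negPf nz) orbF.
  apply/colP=> i; rewrite [RHS]mxE; case: i => [[|[|//]] i].
    by rewrite -[RHS]v00; congr (v _ _); apply/val_inj.
  by rewrite -[RHS]v10; congr (v _ _); apply/val_inj.
rewrite qr_perm_wave // -waveD; apply: wave_ext => z Dz; rewrite !mxE /=.
case: g Dg => h b Dg /=.
case: j => [[|[|//]] ?] /=; case: b {Dg} => /=;
 rewrite ?(cosN trig) ?(sinN trig) ?(cosB trig) ?(sinB trig);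
 rewrite ?expr1 ?expr0; ring.
Qed.
End Waves.

(** * Enumerations and the decomposition *)

Section Decomposition.
Variables (H : finZmodType) (K : fieldType) (cs sn : H -> H -> K).
Hypothesis trig : trig_pairing cs sn.
Local Notation KT := (quandle_ring K H).
Local Notation D := (doubles H).
Implicit Types (u v z w e : H).

(** The u for which chi_u is real on 2H. *)
Definition torsion2 : {set H} := [set u in D | u + u == 0].

Lemma torsion2P u : reflect (u \in D /\ u + u = 0) (u \in torsion2).
Proof. by rewrite inE; apply: (iffP andP) => [] [Du /eqP]. Qed.

Lemma oppr_eq_double u : (- u == u) = (u + u == 0).
Proof. by rewrite eq_sym -addr_eq0. Qed.

Lemma exists_linear_enumeration (m : nat) : #|torsion2| = m ->
  exists phi : 'I_m -> mx_representation K (dih H) 1, enumerates_linear phi.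
Proof.
move=> <-; pose r (j : 'I_#|torsion2|) (g : dih_ambient H) : 'M[K]_1 :=
  (cs (enum_val j) g.1)%:M.
have rP j : mx_repr (dih H) (r j).
  have /torsion2P[Dj j2] := enum_valP j.
  split=> [|[a b] [a' b']]; first by rewrite /r (cos0 trig).
  rewrite !mem_dih /= => Da Da'; rewrite /r -scalar_mxM /=; congr (_ %:M).
  rewrite (cosD trig) (sin_torsion trig Dj Da j2) mul0r subr0.
  by case: (b); rewrite ?(cosN trig).
exists (fun j => MxRepresentation (rP j)); split=> [j | j j' eqj | rG rGs].
- by rewrite /= /r (cos0 trig).
- have /torsion2P[Dj j2] := enum_valP j; have /torsion2P[Dj' _] := enum_valP j'.
  apply: enum_val_inj; case: (cos_inj trig Dj Dj') => [z Dz | -> // |].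
    have Dg : rot_of z \in dih H by rewrite rot_of_dih.
    by move: (eqj _ Dg) => /= /(congr1 (fun A : 'M_1 => A 0 0));
      rewrite /r !mxE.
  by move->; apply/eqP; rewrite eq_sym oppr_eq_double j2.
have [u [Du u2 rGE]] := linear_rep_cos trig rGs.
have Tu : u \in torsion2 by apply/torsion2P.
by exists (enum_rank_in Tu u) => g Dg; rewrite rGE //= /r enum_rankK_in.
Qed.

(** One element of each pair {u, -u} with u <> -u; the enumeration of H serves
    to choose it. *)
Definition half_doubles : {set H} :=
  [set u in D | (u + u != 0) && (enum_rank u < enum_rank (- u))%N].

Lemma half_doublesP u : u \in half_doubles -> u \in D /\ u + u != 0.
Proof. by rewrite !inE => /and3P[]. Qed.

Lemma half_doublesN u : u \in D -> u + u != 0 ->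
  (- u \in half_doubles) = (u \notin half_doubles).
Proof.
move=> Du u2; rewrite !inE doublesN Du u2 /= -opprD oppr_eq0 u2 opprK /=
  -leqNgt.
rewrite ltn_neqAle; case: eqP => // /val_inj/enum_rank_inj/eqP.
by rewrite oppr_eq_double (negPf u2).
Qed.

Lemma card_doubles_split : #|D| = (#|torsion2| + 2 * #|half_doubles|)%N.
Proof.
rewrite -(cardsID torsion2 D) (setIidPr _); last first.
  by apply/subsetP=> u /torsion2P[].
have PD u : (u \in D :\: torsion2) = (u \in D) && (u + u != 0).
  by rewrite in_setD [u \in torsion2]inE; case: (u \in D);
    rewrite ?andbT ?andbF.
congr addn; rewrite -(cardsID half_doubles) (setIidPr _); last first.
  by apply/subsetP=> u Pu; rewrite PD; apply/andP/half_doublesP.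
rewrite mul2n -addnn; congr addn.
rewrite -(card_imset half_doubles (@oppr_inj H)).
apply: eq_card => u; rewrite in_setD PD andbC.
have -> : (u \in [set - v | v in half_doubles]) = (- u \in half_doubles).
  apply/imsetP/idP=> [[v Pv ->]|Pu]; first by rewrite opprK.
  by exists (- u); rewrite ?opprK.
apply/idP/idP=> [/andP[/andP[Du u2] nPu] | PNu]; first by rewrite half_doublesN.
have [] := half_doublesP PNu; rewrite doublesN -opprD oppr_eq0 => Du u2.
by rewrite Du u2 -half_doublesN.
Qed.

(** Conjugation by diag(1, -1), the matrix of s, reverses rotations. *)
Lemma rot_rsimN u : u \in D -> mx_rsim (rot_repr trig u) (rot_repr trig (- u)).
Proof.
move=> Du; exists (rot_mx cs sn u (dih_s H)); first by [].
  apply/row_freeP; exists (rot_mx cs sn u (dih_s H)).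
  rewrite -(repr_mxM (rot_repr trig u)) ?dih_s_mem //.
  have -> : (dih_s H * dih_s H)%g = 1%g by congr (_, _); rewrite /= subr0.
  exact: (repr_mx1 (rot_repr trig u)).
case=> h b; rewrite mem_dih /= => Dh; apply/matrixP=> i j.
rewrite !mxE !big_ord_recl !big_ord0 !mxE /= (cos0 trig) (sin0 trig).
rewrite (cosNl trig Du Dh) (sinNl trig Du Dh) expr1.
by case: i j => [[|[|//]] ?] [[|[|//]] ?] /=; case: (b); rewrite ?expr1 ?expr0;
  ring.
Qed.

Lemma irr2_half (rG : mx_representation K (dih H) 2) : mx_irreducible rG ->
  exists2 u, u \in half_doubles & mx_rsim rG (rot_repr trig u).
Proof.
move=> irrG; have [u [Du u2 simu]] := irr2_rot trig irrG.
case: (boolP (u \in half_doubles)) => Pu; first by exists u.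
exists (- u); first by rewrite half_doublesN.
exact: mx_rsim_trans simu (rot_rsimN Du).
Qed.

(** Distinct parameters give inequivalent representations: the trace is 2 cos_u
    on the translations, and cos_u determines u up to sign. *)
Lemma exists_irr2_enumeration (m : nat) : #|half_doubles| = m ->
  exists psi : 'I_m -> mx_representation K (dih H) 2, enumerates_irr2 psi.
Proof.
move=> <-; have halfP (j : 'I_#|half_doubles|) : enum_val j \in half_doubles.
  exact: enum_valP.
exists (fun j => rot_repr trig (enum_val j)); split=> [j | j j' sim | rG irrG].
- by have [Dj j2] := half_doublesP (halfP j); apply: rot_irr.
- have [Dj j2] := half_doublesP (halfP j);
  have [Dj' _] := half_doublesP (halfP j').
  apply: enum_val_inj; case: (cos_inj trig Dj Dj') => [z Dz | -> // | ].
    have Dg : ((z, false) : dih_ambient H) \in dih H by rewrite mem_dih.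
    have := mxtrace_rsim sim Dg; rewrite /mxtrace !big_ord_recl !big_ord0 !mxE
      /=.
    rewrite expr0 !mul1r !addr0 => tr_eq; apply/eqP; rewrite -subr_eq0.
    apply/eqP/(eq_opp_eq0 trig)/eqP.
    by rewrite -addr_eq0 addrACA tr_eq -opprD subrr.
  by move=> jN; have := halfP j'; rewrite jN half_doublesN // halfP.
have [u Pu simu] := irr2_half irrG.
by exists (enum_rank_in Pu u); rewrite enum_rankK_in.
Qed.

Lemma inj_card_surj (T : finType) (A : {set T}) m (t : 'I_m -> T) :
    #|A| = m -> injective t -> (forall j, t j \in A) ->
  forall x : T, x \in A -> exists j, x = t j.
Proof.
move=> cardA injt tA x Ax; have imA : t @: 'I_m = A.
  apply/eqP; rewrite eqEcard card_imset // cardA card_ord leqnn andbT.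
  by apply/subsetP=> _ /imsetP[j _ ->].
by rewrite -imA in Ax; case/imsetP: Ax => j _ ->; exists j.
Qed.

(** The classification attaches a parameter to every member of an enumeration;
    inequivalent members have distinct parameters, so by cardinality each
    parameter occurs. *)
Lemma linear_parameters m (phi : 'I_m -> mx_representation K (dih H) 1) :
    #|torsion2| = m -> enumerates_linear phi ->
  exists t : 'I_m -> H,
    [/\ forall j, t j \in torsion2,
        forall j, {in dih H, forall g, phi j g = (cs (t j) g.1)%:M}
      & forall u, u \in torsion2 -> exists j, u = t j].
Proof.
move=> card_m [phi_s phi_inj _].
have /fin_all_exists[t tP] j := linear_rep_cos trig (phi_s j).
have tT j : t j \in torsion2 by case: (tP j) => Dt t2 _; apply/torsion2P.
have tE j : {in dih H, forall g, phi j g = (cs (t j) g.1)%:M} by case: (tP j).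
exists t; split=> //; apply: inj_card_surj => // j j' eq_t.
by apply: phi_inj => g Dg; rewrite !tE ?eq_t.
Qed.

Lemma irr2_parameters m (psi : 'I_m -> mx_representation K (dih H) 2) :
    #|half_doubles| = m -> enumerates_irr2 psi ->
  exists r : 'I_m -> H,
    [/\ forall j, r j \in half_doubles,
        forall j, mx_rsim (psi j) (rot_repr trig (r j))
      & forall u, u \in half_doubles -> exists j, u = r j].
Proof.
move=> card_m [psi_irr psi_inj _].
have /fin_all_exists2[r rP rE] j := irr2_half (psi_irr j).
exists r; split=> //; apply: inj_card_surj => // j j' eq_r.
apply: psi_inj; apply: mx_rsim_trans (rE j) _.
by rewrite eq_r; apply: mx_rsim_sym.
Qed.

(** At e + w the right-hand side is the mean over u of cos_u(z) cos_u(w) +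
    sin_u(z) sin_u(w) = cos_u(w - z), which is 1 for w = z and 0 otherwise. *)
Lemma wave_inversion e z : z \in D ->
  qr_basis K (e + z) = \sum_(u in D) (#|D|%:R : K)^-1 *:
    (cs u z *: wave e (cs u) + sn u z *: wave e (sn u)).
Proof.
move=> Dz; apply/ffunP=> y; rewrite sum_ffunE ffunE.
have cD : #|D|%:R != 0 :> K by apply: card_doubles_neq0 trig.
case: (boolP (y \in double_coset e)) => [/double_cosetP[w Dw ->] | nXy];
  last first.
  rewrite big1 => [|u _]; last first.
    by rewrite !ffunE (negPf nXy) !scaler0 addr0 scaler0.
  rewrite (_ : _ == _ = false) //; apply: contraNF nXy => /eqP <-.
  by apply/double_cosetP; exists z.
rewrite (eq_bigr (fun u => (#|D|%:R : K)^-1 * cs u (w - z))) => [|u Du];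
  last first.
  rewrite ffunE [X in _ *: X]ffunE; congr (_ * _).
  by rewrite (cosB trig) ffunE waveE // ffunE waveE // mulrC [sn u w * _]mulrC.
rewrite -mulr_sumr (sum_cosE trig) ?doublesB // subr_eq0 (inj_eq (addrI e))
  eq_sym.
by case: eqP => _; rewrite ?mulr0 ?mulVf.
Qed.

(** Since cos_(-u) = cos_u and sin_(-u) = - sin_u, and sin_u = 0 when 2u = 0,
    the sum contains the waves of all u in 2H, hence the basis of K[X] by
    Fourier inversion. *)
Lemma wave_span m1 m2 (t : 'I_m1 -> H) (r : 'I_m2 -> H) e :
    (forall u, u \in torsion2 -> exists j, u = t j) ->
    (forall u, u \in half_doubles -> exists j, u = r j) ->
  (\sum_j <[wave e (cs (t j))]>
   + \sum_j (<[wave e (cs (r j))]> + <[wave e (sn (r j))]>))%VS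
  = qr_span K (double_coset e).
Proof.
move=> t_surj r_surj; set S := (_ + _)%VS.
apply/eqP; rewrite eqEsubv; apply/andP; split.
  rewrite subv_add; apply/andP; split; apply/subv_sumP=> j _.
    by rewrite -memvE wave_supp.
  by rewrite subv_add -!memvE !wave_supp.
have waves_half u : u \in half_doubles ->
    wave e (cs u) \in S /\ wave e (sn u) \in S.
  case/r_surj=> j ->.
  have sS : (<[wave e (cs (r j))]> + <[wave e (sn (r j))]> <= S)%VS.
    by apply: subv_trans (addvSr _ _); rewrite (sumv_sup j).
  by split; apply: (subvP sS); rewrite ?(subvP (addvSl _ _) _ (memv_line _))
    ?(subvP (addvSr _ _) _ (memv_line _)).
have waves u : u \in D -> wave e (cs u) \in S /\ wave e (sn u) \in S.
  move=> Du; have [u2 | u2] := eqVneq (u + u) 0.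
    have [|j uj] := t_surj u; first by apply/torsion2P.
    split.
      apply: (subvP (addvSl _ _)).
      apply: (subvP (_ : <[wave e (cs u)]> <= _)%VS).
        by rewrite uj (sumv_sup j).
      exact: memv_line.
    rewrite (@wave_ext _ _ _ _ (fun=> 0)) => [|z Dz];
      last exact: (sin_torsion trig Du Dz).
    by rewrite (_ : wave e _ = 0) ?mem0v //; apply/ffunP=> y;
      rewrite !ffunE if_same.
  case: (boolP (u \in half_doubles)) => [|nPu]; first exact: waves_half.
  have [] := waves_half (- u); first by rewrite half_doublesN.
  rewrite (@wave_ext _ _ e (cs (- u)) (cs u)) => [|z Dz];
    last exact: (cosNl trig).
  rewrite (@wave_ext _ _ e (sn (- u)) (fun z => - sn u z)) => [|z Dz];
    last exact: (sinNl trig).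
  have -> : wave e (fun z => - sn u z) = - wave e (sn u).
    by apply/ffunP=> y; rewrite !ffunE; case: ifP => // _; rewrite oppr0.
  by rewrite memvN.
apply/span_subvP=> _ /mapP[y + ->]; rewrite mem_enum => /double_cosetP[z Dz ->].
rewrite wave_inversion // memv_suml // => u /waves[Sc Ss].
by rewrite memvZ // memvD // memvZ.
Qed.

(** The sum is everything by Fourier inversion on each coset; it is direct
    because the dimensions add up to N (m1 + 2 m2) = N |2H| = |H|. *)
Lemma takasaki_decomposition N m1 m2 (e : 'I_N -> H)
    (phi : 'I_m1 -> mx_representation K (dih H) 1)
    (psi : 'I_m2 -> mx_representation K (dih H) 2) :
    (forall y, exists i, y \in double_coset (e i)) -> (N * #|D| = #|H|)%N ->
    #|torsion2| = m1 -> #|half_doubles| = m2 ->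
    enumerates_linear phi -> enumerates_irr2 psi ->
  exists (U : 'I_N -> 'I_m1 -> {vspace KT}) (V : 'I_N -> 'I_m2 -> {vspace KT}),
    [/\ (\sum_i (\sum_j U i j + \sum_j V i j))%VS = fullv,
        directv (\sum_i (\sum_j U i j + \sum_j V i j)),
        forall i, (\sum_j U i j + \sum_j V i j)%VS
                  = qr_span K (double_coset (e i)),
        (forall i j, simple_right_ideal (@takasaki H) (U i j)) /\
        (forall i j, simple_right_ideal (@takasaki H) (V i j))
      & (forall i j, affords (double_coset (e i)) (e i) (U i j) (phi j)) /\
        (forall i j, affords (double_coset (e i)) (e i) (V i j) (psi j))].
Proof.
move=> cover cardN card1 card2 enum1 enum2.
have [t [tT tE t_surj]] := linear_parameters card1 enum1.
have [r [rP rE r_surj]] := irr2_parameters card2 enum2.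
pose U i j : {vspace KT} := <[wave (e i) (cs (t j))]>%VS.
pose V i j : {vspace KT} :=
  (<[wave (e i) (cs (r j))]> + <[wave (e i) (sn (r j))]>)%VS.
have affU i j : affords (double_coset (e i)) (e i) (U i j) (phi j).
  by have /torsion2P[Dt t2] := tT j; exact: (affords_cos trig _ Dt t2 (tE j)).
have affV i j : affords (double_coset (e i)) (e i) (V i j) (psi j).
  have [Dr r2] := half_doublesP (rP j).
  by apply: affords_rsim (rE j) _; apply: (affords_rot trig).
have sum_orbit i :
    (\sum_j U i j + \sum_j V i j)%VS = qr_span K (double_coset (e i)).
  exact: wave_span.
have sum_full : (\sum_i (\sum_j U i j + \sum_j V i j))%VS = fullv.
  apply/eqP; rewrite eqEsubv subvf; apply/subvP=> u _.
  rewrite [u]qr_sum_basis memv_suml // => y _; rewrite memvZ //.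
  have [i Xy] := cover y.
  apply: (subvP (sumv_sup i _ (subvv _))) => //.
  by rewrite sum_orbit memv_span // map_f // mem_enum.
have sU i j : (U i j <= qr_span K (double_coset (e i)))%VS.
  by rewrite -sum_orbit; apply: subv_trans (addvSl _ _); rewrite (sumv_sup j).
have sV i j : (V i j <= qr_span K (double_coset (e i)))%VS.
  by rewrite -sum_orbit; apply: subv_trans (addvSr _ _); rewrite (sumv_sup j).
exists U, V; split=> //; last first.
  split=> i j; first exact: affords_simple (irr_linear _) (affU i j) (sU i j).
  by have [psi_irr _ _] := enum2; apply: affords_simple (psi_irr j) (affV i j)
    (sV i j).
rewrite directvE /= sum_full dimvf.
under eq_bigr => i _.
  under eq_bigr do rewrite (affords_dim (affU i _)).
  under [X in (_ + X)%N]eq_bigr do rewrite (affords_dim (affV i _)).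
  over.
rewrite !sum_nat_const !card_ord muln1 mulnC.
have -> : dim KT = (#|H| * 1)%N by [].
by rewrite muln1 -cardN card_doubles_split card1 card2 mulnC [(m2 * 2)%N]mulnC.
Qed.

Lemma card_double_cosets N (e : 'I_N -> H) :
    (forall y, exists i, y \in double_coset (e i)) ->
    (forall i i', e i' \in double_coset (e i) -> i = i') ->
  (N * #|D| = #|H|)%N.
Proof.
move=> cover disj.
pose f (p : 'I_N * H) := e p.1 + p.2.
have <- : #|f @: setX [set: 'I_N] D| = #|H|.
  rewrite -cardsT; congr #|pred_of_set _|; apply/setP=> y; rewrite inE.
  have [i /double_cosetP[z Dz ->]] := cover y.
  by apply/imsetP; exists (i, z); rewrite ?inE.
rewrite [RHS]card_in_imset ?cardsX ?cardsT ?card_ord //.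
move=> [i z] [i' z']; rewrite !in_setX /= => /andP[_ Dz] /andP[_ Dz'] eqf.
rewrite /f /= in eqf.
have eqi : i = i'.
  apply: disj; apply/double_cosetP; exists (z - z'); first exact: doublesB.
  by rewrite addrA eqf addrK.
by move: eqf; rewrite eqi => /addrI->.
Qed.
End Decomposition.

(** * Characters from roots of unity *)

Lemma closed_prim_root (C : numClosedFieldType) (n : nat) : (0 < n)%N ->
  exists z : C, n.-primitive_root z.
Proof.
move=> n_gt0; pose p : {poly C} := 'X^n - 1.
have [r Dp] := closed_field_poly_normal p.
rewrite (monicP _) ?monicXnsubC // scale1r in Dp.
have rn1 : all n.-unity_root r by apply/allP=> z; rewrite -root_prod_XsubC -Dp.
have sz_r : (n < (size r).+1)%N.
  by rewrite -(size_prod_XsubC r id) -Dp size_XnsubC.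
have [|z _ prim_z] := hasP (has_prim_root n_gt0 rn1 _ sz_r); last by exists z.
by rewrite -separable_prod_XsubC -Dp separable_Xn_sub_1 // pnatr_eq0 -lt0n.
Qed.

Section Bicharacter.
Variables (R : rcfType) (H : finZmodType) (b : H -> H -> R[i]).
Hypotheses (bC : forall x y, b x y = b y x)
  (bD : forall x y z, b x (y + z) = b x y * b x z)
  (b_norm : forall x y, `|b x y| = 1)
  (b_nondeg : forall x, x != 0 -> exists y, b x y != 1).
Local Notation D := (doubles H).
Implicit Types (u x y z w : H).

Definition half_of u : H := odflt 0 [pick x | x + x == u].

Lemma halfK u : u \in D -> half_of u + half_of u = u.
Proof.
case/doublesP=> x ->; rewrite /half_of; case: pickP => [y /eqP//|/(_ x)].
by rewrite eqxx.
Qed.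

Let b_neq0 x y : b x y != 0.
Proof. by rewrite -normr_eq0 b_norm oner_eq0. Qed.

Let bDl x x' z : b (x + x') z = b x z * b x' z.
Proof. by rewrite !(bC _ z) bD. Qed.

Let b0 x : b x 0 = 1.
Proof. by apply: (mulfI (b_neq0 x 0)); rewrite -bD addr0 mulr1. Qed.

Let bN x y : b x (- y) = (b x y)^*%C.
Proof.
apply: (mulfI (b_neq0 x y)); rewrite -bD subrr b0.
by rewrite -sqr_normc b_norm expr1n.
Qed.

(** For z = 2y one has b(x, z) = b(2x, y), so the characters chi_u of 2H do not
    depend on the choice of a half of u. *)
Let b_half x x' z : z \in D -> x + x = x' + x' -> b x z = b x' z.
Proof.
by case/doublesP=> y -> eqx; rewrite !bD !(bC _ y) -!bD eqx.
Qed.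

(** Choose y with b(y, z) <> 1: shifting u by 2y multiplies the sum by
    b(y, z). *)
Lemma sum_half_character z : z \in D -> z != 0 ->
  \sum_(u in D) b (half_of u) z = 0.
Proof.
move=> Dz nz; have [y] := b_nondeg nz; rewrite bC => by1.
apply/eqP; have : (\sum_(u in D) b (half_of u) z) * (b y z - 1) == 0.
  rewrite mulrBr mulr1 subr_eq0; apply/eqP.
  rewrite mulr_suml [RHS](reindex_inj (addIr (y + y))) /=.
  apply: eq_big => u; last first.
    move=> Du; rewrite -bDl; apply: b_half => //.
    by rewrite addrACA !halfK ?(doublesD Du) ?mem_double.
  apply/idP/idP=> [Du | Du]; first by rewrite doublesD ?mem_double.
  by rewrite -(addrK (y + y) u) doublesB ?mem_double.
by rewrite mulf_eq0 subr_eq0 (negPf by1) orbF.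
Qed.

Variables (K : fieldType) (iota : {rmorphism R -> K}).

Lemma trig_pairing_of_bicharacter :
  trig_pairing (fun u z => iota (complex.Re (b (half_of u) z)))
               (fun u z => iota (complex.Im (b (half_of u) z))).
Proof.
have ReM (x y : R[i]) : complex.Re (x * y)
    = complex.Re x * complex.Re y - complex.Im x * complex.Im y.
  by case: x y => ? ? [].
have ImM (x y : R[i]) : complex.Im (x * y)
    = complex.Im x * complex.Re y + complex.Re x * complex.Im y.
  by case: x y => ? ? [? ?] /=; rewrite addrC.
have sym u z : u \in D -> z \in D -> b (half_of u) z = b (half_of z) u.
  move=> Du Dz; rewrite -{1}(halfK Dz) bD -[X in _ = b _ X](halfK Du) bD.
  by rewrite (bC (half_of z)).
split.
- by move=> p; rewrite (fmorph_pchar iota) pchar_num.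
- by move=> u; rewrite b0 rmorph1.
- by move=> u z; rewrite bN; case: (b _ _).
- by move=> u z; rewrite bN; case: (b _ _) => ? ? /=; rewrite rmorphN.
- by move=> u z w; rewrite bD ReM rmorphB !rmorphM.
- by move=> u z w; rewrite bD ImM rmorphD !rmorphM.
- by move=> u z Du Dz; rewrite sym.
- by move=> u z Du Dz; rewrite sym.
move=> z Dz nz; rewrite -rmorph_sum.
have ReD : {morph (@complex.Re R) : x y / x + y} by case=> ? ? [].
by rewrite -(big_morph _ ReD (erefl : complex.Re 0 = 0)) sum_half_character
  ?rmorph0.
Qed.
End Bicharacter.

Section CyclicProdPairing.
Variables (I : finType) (N : I -> nat).
Hypothesis N_gt0 : forall l, (0 < N l)%N.
Local Notation H := (cyclic_prod N).

Lemma cp_addE (a c : H) l : (a + c) l = ((a l + c l) %% N l)%N :> nat.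
Proof. by rewrite ffunE /=; congr (_ %% _)%N; rewrite prednK. Qed.

Lemma cp_ltn (a : H) l : (a l < N l)%N.
Proof.
by have := ltn_ord (a l); rewrite [X in (_ < X)%N](prednK (N_gt0 l)).
Qed.

Definition cp_of (f : I -> nat) : H := [ffun l => inZp (f l)].

Lemma cp_ofE f l : cp_of f l = (f l %% N l)%N :> nat.
Proof. by rewrite ffunE /=; congr (_ %% _)%N; rewrite prednK. Qed.

Lemma cp_eqP (a c : H) : (forall l, a l = c l :> nat) <-> a = c.
Proof. by split=> [eq_ac | ->] //; apply/ffunP=> l; apply/val_inj/eq_ac. Qed.

Lemma cp_zeroE l : (0 : H) l = 0%N :> nat.
Proof. by rewrite ffunE. Qed.

(** Fix a primitive N_l-th root of unity zeta_l for each factor. The pairing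
    prod_l zeta_l^(x_l y_l) of x with the l-th coordinate vector is
    zeta_l^(x_l), so it is nondegenerate. *)
Lemma cyclic_prod_bicharacter (R : rcfType) : exists b : H -> H -> R[i],
  [/\ forall x y, b x y = b y x,
      forall x y z, b x (y + z) = b x y * b x z,
      forall x y, `|b x y| = 1
    & forall x, x != 0 -> exists y, b x y != 1].
Proof.
have /fin_all_exists[zeta zetaP] l := closed_prim_root R[i] (N_gt0 l).
exists (fun x y : H => \prod_l zeta l ^+ (x l * y l));
  split=> [x y|x y z|x y|x nzx].
- by apply: eq_bigr => l _; rewrite mulnC.
- rewrite -big_split /=; apply: eq_bigr => l _.
  by rewrite cp_addE -exprD -mulnDr ![(x l * _)%N]mulnC !exprM prim_expr_mod.
- rewrite normr_prod big1 // => l _; rewrite normrX.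
  suff /eqP-> : `|zeta l| == 1 by rewrite expr1n.
  rewrite -(pexpr_eq1 (N_gt0 l)) ?normr_ge0 // -normrX.
  by rewrite (prim_expr_order (zetaP l)) normr1.
have [l nzl] : exists l, (x l : nat) != 0%N.
  case: (pickP [pred l | (x l : nat) != 0%N]) => [l nzl | x0];
    first by exists l.
  case/eqP: nzx; apply/cp_eqP=> l; rewrite cp_zeroE.
  by have := x0 l; rewrite /= => /negbFE/eqP.
exists (cp_of (fun l' => l' == l)); rewrite (bigD1 l) //= [X in _ * X]big1 =>
  [|l' ne].
  have N_gt1 : (1 < N l)%N.
    rewrite ltn_neqAle N_gt0 andbT; apply: contraNneq nzl => N1.
    by rewrite -leqn0 -ltnS [X in (_ < X)%N]N1 cp_ltn.
  rewrite cp_ofE eqxx modn_small // muln1 mulr1 -(prim_order_dvd (zetaP l)).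
  by apply: contra nzl => /dvdn_leq; rewrite lt0n; case: eqP => // _ /(_ isT);
    rewrite leqNgt cp_ltn.
by rewrite cp_ofE (negPf ne) mod0n muln0.
Qed.
End CyclicProdPairing.

(** * The product of cyclic groups *)

Lemma eq_from_bits K i j : (i < 2 ^ K)%N -> (j < 2 ^ K)%N ->
  (forall p, (p < K)%N -> odd (i %/ 2 ^ p) = odd (j %/ 2 ^ p)) -> i = j.
Proof.
elim: K i j => [|K IH] i j.
  by rewrite !expn0 !ltnS !leqn0 => /eqP-> /eqP->.
rewrite expnS => ltiK ltjK bits.
have e0 : odd i = odd j by have := bits 0%N isT; rewrite expn0 !divn1.
suff e2 : (i %/ 2 = j %/ 2)%N.
  by rewrite -(odd_double_half i) -(odd_double_half j) e0 -!divn2 e2.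
apply: IH => [||p ltpK]; rewrite ?ltn_divLR // 1?mulnC //.
by rewrite -!divnMA -expnS bits.
Qed.

Lemma double_mod0 v M : (v < M)%N -> ((v + v) %% M = 0)%N ->
  v = 0%N \/ (v + v = M)%N.
Proof.
move=> ltvM; have [lt | le] := ltnP (v + v) M.
  by rewrite modn_small //; lia.
rewrite -[in (v + v)%N](subnK le) modnDr modn_small; lia.
Qed.

Section Moduli.
Variables (k k' d' : nat).
Variables (n : 'I_k -> nat) (n' : 'I_k' -> nat) (m' : 'I_d' -> nat).
Hypotheses (hn : forall a, (0 < n a)%N /\ ~~ odd (n a))
  (hn' : forall b, odd (n' b)) (hm' : forall c, odd (m' c)).
Local Notation N := (moduli n n' m').
Local Notation H := (cyclic_prod N).

Lemma moduli_gt0 l : (0 < N l)%N.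
Proof.
case: l => [[a|b]|c] /=; last exact: odd_gt0.
  by have [n_gt0 _] := hn a; rewrite muln_gt0.
by rewrite muln_gt0 /= odd_gt0.
Qed.

Lemma moduli_even l : odd (N (inl l)) = false.
Proof. by case: l => [a|b] /=; rewrite oddM. Qed.

(** Modulo an odd m every z is a double, as z or z + m is even. *)
Lemma doubles_parityP (z : H) :
  reflect (forall l, ~~ odd (z (inl l))) (z \in doubles H).
Proof.
apply: (iffP idP) => [/doublesP[y ->] l | even_z].
  rewrite (cp_addE moduli_gt0) odd_mod ?moduli_even //.
  by rewrite addnn odd_double.
pose y := cp_of N (fun l => match l with
  | inl _ => (z l)./2
  | inr c => if odd (z l) then (z l + N l)./2 else (z l)./2 end).
apply/doublesP; exists y; apply/cp_eqP=> l.
rewrite (cp_addE moduli_gt0) !(cp_ofE moduli_gt0) modnDm.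
have zl := cp_ltn moduli_gt0 z l; case: l zl => [l|c] zl.
  by rewrite addnn even_halfK ?modn_small.
have := hm' c; case: ifP => oz oc; last by rewrite addnn even_halfK ?oz
  ?modn_small.
rewrite addnn even_halfK; last by rewrite oddD oz /= oc.
by rewrite modnDr modn_small.
Qed.

Lemma parityD (a c : H) l :
  odd ((a + c)%R (inl l)) = odd (a (inl l)) (+) odd (c (inl l)).
Proof. by rewrite (cp_addE moduli_gt0) odd_mod ?moduli_even // oddD. Qed.

Lemma double_coset_parityP (e y : H) :
  reflect (forall l, odd (y (inl l)) = odd (e (inl l))) (y \in double_coset e).
Proof.
rewrite inE; apply: (iffP (doubles_parityP _)) => par l;
  have := parityD (y - e) e l;
  rewrite subrK; first by rewrite (negPf (par l)).
by rewrite par; case: (odd (e _)); case: odd.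
Qed.

Lemma label_parity (i : nat) l :
  odd (label n n' m' i (inl l))
  = label_digit i (inl l : 'I_k + 'I_k' + 'I_d').
Proof.
rewrite /label (cp_ofE moduli_gt0) modn_small ?oddb //.
have : (0 < N (inl l))%N by apply: moduli_gt0.
by case: l => [a|b] /=; case: odd => /=; lia.
Qed.

Lemma label_digit_inj (i j : 'I_(2 ^ (k + k'))) :
  (forall l, label_digit i (inl l : 'I_k + 'I_k' + 'I_d') =
             label_digit j (inl l : 'I_k + 'I_k' + 'I_d')) -> i = j.
Proof.
move=> eqd; apply/val_inj/(eq_from_bits (ltn_ord i) (ltn_ord j)) => p ltp.
have [ltpk' | lek'p] := ltnP p k'.
  have lt_b : (k' - p.+1 < k')%N by lia.
  have := eqd (inr (Ordinal lt_b)); rewrite /=.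
  by have -> : (k' - (k' - p.+1).+1 = p)%N by lia.
have lt_a : (k + k' - p.+1 < k)%N by lia.
have := eqd (inl (Ordinal lt_a)); rewrite /=.
by have -> : (k + k' - (k + k' - p.+1).+1 = p)%N by lia.
Qed.

Lemma label_cover (y : H) :
  exists i : 'I_(2 ^ (k + k')), y \in double_coset (label n n' m' i : H).
Proof.
pose dig (i : 'I_(2 ^ (k + k'))) : {ffun 'I_k + 'I_k' -> bool} :=
  [ffun l => label_digit i (inl l : 'I_k + 'I_k' + 'I_d')].
have dig_inj : injective dig.
  move=> i j /ffunP eqd; apply: label_digit_inj => l.
  by have := eqd l; rewrite !ffunE.
have : [ffun l => odd (y (inl l))] \in codom dig.
  apply: inj_card_onto => //.
  by rewrite card_ffun card_bool card_sum !card_ord.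
case/codomP=> i /ffunP eqi; exists i; apply/double_coset_parityP=> l.
by rewrite label_parity; have := eqi l; rewrite !ffunE.
Qed.

Lemma label_disjoint (i j : 'I_(2 ^ (k + k'))) :
  (label n n' m' j : H) \in double_coset (label n n' m' i : H) -> i = j.
Proof.
move/double_coset_parityP=> par; apply: label_digit_inj => l.
by rewrite -!label_parity par.
Qed.

(** The solutions of 2u = 0 in Z/2q are 0 and q, and q is a double exactly when
    it is even; in the odd factors 0 is the only solution. *)
Lemma card_torsion2 : #|torsion2 H| = (2 ^ k)%N.
Proof.
pose s (eps : {ffun 'I_k -> bool}) : H := cp_of N (fun l =>
  match l with inl (inl a) => (eps a * n a)%N | _ => 0%N end).
have sE eps a : s eps (inl (inl a)) = (eps a * n a)%N :> nat.
  by rewrite (cp_ofE moduli_gt0) modn_small //=; have [n_gt0 _] := hn a;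
    case: (eps a) => /=; lia.
have s_inj : injective s.
  move=> x y /cp_eqP eqs; apply/ffunP=> a; have := eqs (inl (inl a)).
  by rewrite !sE; have [n_gt0 _] := hn a; case: (x a) (y a) => [] [] //=; lia.
have <- : #|s @: {ffun 'I_k -> bool}| = (2 ^ k)%N.
  by rewrite card_imset // card_ffun card_bool card_ord.
apply: eq_card => u; apply/torsion2P/imsetP => [[Du u2] | [eps _ ->]].
  exists [ffun a => (u (inl (inl a)) : nat) != 0%N] => //; apply/cp_eqP=> l.
  have ul := cp_ltn moduli_gt0 u l.
  have u2l : ((u l + u l) %% N l = 0)%N by rewrite -(cp_addE moduli_gt0) u2
    cp_zeroE.
  case: l ul u2l => [[a|b]|c] ul u2l.
  - rewrite sE ffunE; case: (double_mod0 ul u2l) => [->|] //=.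
    by have := hn a; case: eqP; lia.
  - rewrite (cp_ofE moduli_gt0) mod0n; case: (double_mod0 ul u2l) => //= vv.
    have := doubles_parityP _ Du (inr b); have := hn' b.
    suff -> : u (inl (inr b)) = n' b :> nat by move->.
    by apply: double_inj; rewrite -addnn -mul2n.
  - rewrite (cp_ofE moduli_gt0) mod0n; case: (double_mod0 ul u2l) => //= vv.
    by have := congr1 odd vv; rewrite addnn odd_double hm'.
split; last first.
  apply/cp_eqP=> l; rewrite (cp_addE moduli_gt0) cp_zeroE.
  case: l => [[a|b]|c]; rewrite ?sE ?(cp_ofE moduli_gt0) ?mod0n //=.
  by case: (eps a); rewrite ?mod0n // mul1n addnn -mul2n modnn.
apply/doubles_parityP=> -[a|b].
  by rewrite sE oddM; have [_ /negPf->] := hn a; rewrite andbF.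
by rewrite (cp_ofE moduli_gt0) mod0n.
Qed.

(** Applied to the element with all coordinates 1, the hypothesis says that each
    modulus divides 4. *)
Lemma elementary_moduli : (forall y : H, y + y + (y + y) = 0) ->
  [/\ forall a, n a = 2%N, forall b, n' b = 1%N & forall c, m' c = 1%N].
Proof.
move=> four0; have dvd4 l : (N l %| 4)%N.
  have := congr1 (fun x : H => x l : nat) (four0 (cp_of N (fun=> 1%N))).
  rewrite /= !(cp_addE moduli_gt0) !(cp_ofE moduli_gt0) cp_zeroE.
  by rewrite [((1 %% _ + 1 %% _) %% _)%N]modnDm modnDm => /eqP.
have dvd_four q : (q %| 4)%N -> q = 1%N \/ q = 2%N \/ q = 4%N.
  rewrite (dvdn_divisors q (isT : 0 < 4)%N) !inE.
  by case/or3P=> /eqP->; auto.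
split=> [a|b|c].
- have [n_gt0 n_even] := hn a; have := dvd_four _ (dvd4 (inl (inl a))) => /= E.
  have [] : n a = 1%N \/ n a = 2%N by lia.
    by move=> n1; rewrite n1 in n_even.
  by [].
- have n'_odd := hn' b; have := dvd_four _ (dvd4 (inl (inr b))) => /= E.
  have [] : n' b = 1%N \/ n' b = 2%N by lia.
    by [].
  by move=> n2; rewrite n2 in n'_odd.
- by have /dvd_four := dvd4 (inr c); have := hm' c; rewrite /= => o [|[]] E //;
  rewrite E in o.
Qed.

Lemma elementary_bijection : (forall y : H, y + y + (y + y) = 0) ->
  exists (p q : nat)
         (f : {additive H -> ({ffun 'I_p -> 'Z_2} * {ffun 'I_q -> 'Z_4})%type}),
    bijective f.
Proof.
case/elementary_moduli=> n2 n'1 m'1; exists k', k.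
pose f0 (h : H) : ({ffun 'I_k' -> 'Z_2} * {ffun 'I_k -> 'Z_4})%type :=
  ([ffun b => inZp (h (inl (inr b)))], [ffun a => inZp (h (inl (inl a)))]).
have N2 b : N (inl (inr b)) = 2%N by rewrite /= n'1.
have N4 a : N (inl (inl a)) = 4%N by rewrite /= n2.
have N1 c : N (inr c) = 1%N by rewrite /= m'1.
have f1E h b : (f0 h).1 b = h (inl (inr b)) :> nat.
  by rewrite ffunE /= modn_small // -[X in (_ < X)%N](N2 b) cp_ltn // => l;
    apply: moduli_gt0.
have f2E h a : (f0 h).2 a = h (inl (inl a)) :> nat.
  by rewrite ffunE /= modn_small // -[X in (_ < X)%N](N4 a) cp_ltn // => l;
    apply: moduli_gt0.
have f0D : nmod_morphism f0.
  split=> [|x y]; apply: injective_projections; apply/ffunP=> i; apply/val_inj.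
  - by rewrite [LHS]f1E cp_zeroE ffunE.
  - by rewrite [LHS]f2E cp_zeroE ffunE.
  - rewrite [LHS]f1E (cp_addE moduli_gt0) [in RHS]ffunE.
    by transitivity (((f0 x).1 i + (f0 y).1 i) %% 2)%N; rewrite // !f1E;
      congr (_ %% _)%N.
  - rewrite [LHS]f2E (cp_addE moduli_gt0) [in RHS]ffunE.
    by transitivity (((f0 x).2 i + (f0 y).2 i) %% 4)%N; rewrite // !f2E;
      congr (_ %% _)%N.
pose f : {additive H -> _} :=
  HB.pack f0 (GRing.isNmodMorphism.Build _ _ f0 f0D).
exists f.
pose g (pq : {ffun 'I_k' -> 'Z_2} * {ffun 'I_k -> 'Z_4}) : H :=
  cp_of N (fun l => match l with
    | inl (inl a) => pq.2 a | inl (inr b) => pq.1 b | inr _ => 0%N end).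
exists g => [h | pq].
  apply/cp_eqP=> l; rewrite (cp_ofE moduli_gt0);
    have hl := cp_ltn moduli_gt0 h l.
  case: l hl => [[a|b]|c] hl; rewrite ?[f h]/(f0 h) ?f1E ?f2E ?modn_small
    ?moduli_gt0 //.
  by apply/esym/eqP; rewrite -leqn0 -ltnS -[X in (_ < X)%N](N1 c).
rewrite [f _]/(f0 _); apply: injective_projections; apply/ffunP=> i;
  apply/val_inj.
  by rewrite [LHS]f1E (cp_ofE moduli_gt0) N2 modn_small // ltn_ord.
by rewrite [LHS]f2E (cp_ofE moduli_gt0) N4 modn_small // ltn_ord.
Qed.

Lemma exists_double_order_gt2 :
    (~ exists (p q : nat)
         (f : {additive H -> ({ffun 'I_p -> 'Z_2} * {ffun 'I_q -> 'Z_4})%type}),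
       bijective f) ->
  exists2 w : H, w \in doubles H & w + w != 0.
Proof.
move=> not_elem; case: (pickP [pred w in doubles H | w + w != 0]).
  by move=> w /andP[Dw w2]; exists w.
move=> all0; case: not_elem; apply: elementary_bijection => y.
by have := all0 (y + y); rewrite /= mem_double /= => /negbFE/eqP.
Qed.

End Moduli.

Lemma real_subfield (R : realType) (K : fieldType) :
    K = (R : fieldType) \/ K = (R[i] : fieldType) ->
  exists iota : {rmorphism R -> K}, True.
Proof.
by case=> ->; [exists idfun | exists (real_complex R)].
Qed.

(** * The decomposition theorem *)

Theorem theorem6p9 (R : realType) (K : fieldType)
    (hK : K = (R : fieldType) \/ K = (R[i] : fieldType))
    (k k' d' : nat)
    (n : 'I_k -> nat) (n' : 'I_k' -> nat) (m' : 'I_d' -> nat)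
    (hn : forall a, (0 < n a)%N /\ ~~ odd (n a))
    (hn' : forall b, odd (n' b))
    (hm' : forall c, odd (m' c))
    (hkk' : (1 <= k + k')%N)
    (hH : ~ exists (p q : nat)
              (f : {additive cyclic_prod (moduli n n' m') ->
                     ({ffun 'I_p -> 'Z_2} * {ffun 'I_q -> 'Z_4})%type}),
            bijective f) :
  let H : finZmodType := cyclic_prod (moduli n n' m') in
  let KT := quandle_ring K H in
  let X (i : 'I_(2 ^ (k + k'))) : {set H} := orbit_of n n' m' i in
  let e (i : 'I_(2 ^ (k + k'))) : H := label n n' m' i in
  let N1 := (2 ^ k)%N in
  let N2 := ((#|doubles H| - 2 ^ k) %/ 2)%N in
  [/\ forall i, dih_identification (X i) (e i),
      exists phi : 'I_N1 -> mx_representation K (dih H) 1,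
        enumerates_linear phi,
      exists psi : 'I_N2 -> mx_representation K (dih H) 2,
        enumerates_irr2 psi
    & forall (phi : 'I_N1 -> mx_representation K (dih H) 1)
             (psi : 'I_N2 -> mx_representation K (dih H) 2),
        enumerates_linear phi -> enumerates_irr2 psi ->
        exists (U : 'I_(2 ^ (k + k')) -> 'I_N1 -> {vspace KT})
               (V : 'I_(2 ^ (k + k')) -> 'I_N2 -> {vspace KT}),
          [/\ (\sum_i (\sum_j U i j + \sum_j V i j))%VS = fullv,
              directv (\sum_i (\sum_j U i j + \sum_j V i j)),
              forall i, (\sum_j U i j + \sum_j V i j)%VS = qr_span K (X i),
              (forall i j, simple_right_ideal (@takasaki H) (U i j)) /\
              (forall i j, simple_right_ideal (@takasaki H) (V i j))
            & (forall i j, affords (X i) (e i) (U i j) (phi j)) /\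
              (forall i j, affords (X i) (e i) (V i j) (psi j))]].
Proof.
move=> H KT X e N1 N2.
have XE i : X i = double_coset (e i) by apply: orbit_inn.
have [iota _] := real_subfield hK.
have N_gt0 := moduli_gt0 hn hn' hm'.
have [b [bC bD b_norm b_nondeg]] := cyclic_prod_bicharacter N_gt0 R.
have trig := trig_pairing_of_bicharacter bC bD b_norm b_nondeg iota.
have card1 : #|torsion2 H| = N1 by apply: card_torsion2.
have card2 : #|half_doubles H| = N2.
  by rewrite /N2 card_doubles_split card1 addKn mulKn.
have cover : forall y, exists i, y \in double_coset (e i) by apply: label_cover.
have cardH : (2 ^ (k + k') * #|doubles H| = #|H|)%N.
  by apply: (card_double_cosets cover) => i j; apply: label_disjoint.
split.
- move=> i; rewrite XE; apply: dih_identification_coset.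
  exact: exists_double_order_gt2 hH.
- exact: exists_linear_enumeration trig _ card1.
- exact: exists_irr2_enumeration trig _ card2.
move=> phi psi enum_phi enum_psi.
have [U [V [sum_full dir sum_orbit simple [affU affV]]]] :=
  takasaki_decomposition trig cover cardH card1 card2 enum_phi enum_psi.
by exists U, V; split=> // [i | ]; rewrite ?XE //; split=> i j; rewrite XE.
Qed.
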